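(* It is undecidable, given a finite set $\{M_1,\ldots,M_k\}$ of $4\times4$ matrices with integer entries, whether the identity matrix $I_4$ belongs to the multiplicative semigroup generated by $\{M_1,\ldots,M_k\}$ (i.e. whether $I_4$ is a product $M_{l_1}\cdots M_{l_r}$ with $r\ge1$). This remains undecidable when the number of generators is fixed to $k=48$. *)

(* Defs.v *)
From HB Require Import structures.
From mathcomp Require Import all_boot all_order all_algebra.
Set Implicit Arguments. Unset Strict Implicit. Unset Printing Implicit Defensive.
Import Order.TTheory GRing.Theory Num.Theory.

(* Model of computation: Minsky (counter) machines.                          *)

Inductive instr : Type :=
| INC of nat
| DEC of nat & nat.

Definition program := seq instr.

(* configuration: program counter and register file (missing regs = 0) *)
Definition config := (nat * seq nat)%type.

Definition reg (regs : seq nat) (r : nat) : nat := nth 0%N regs r.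
Definition setreg (regs : seq nat) (r v : nat) : seq nat := set_nth 0%N regs r v.

Definition step (P : program) (c : config) : option config :=
  let: (pc, regs) := c in
  if (pc < size P)%N then
    match nth (INC 0) P pc with
    | INC r => Some (pc.+1, setreg regs r (reg regs r).+1)
    | DEC r j =>
        if reg regs r is k.+1 then Some (pc.+1, setreg regs r k)
        else Some (j, regs)
    end
  else None.

Fixpoint run (P : program) (n : nat) (c : config) : config :=
  if n is n'.+1 then
    match step P c with Some c' => run P n' c' | None => c end
  else c.

Definition halts_with (P : program) (x y : nat) : Prop :=
  exists n, let c := run P n (0%N, [:: x]) in
            step P c = None /\ reg c.2 0 = y.

Definition decides_on {T : Type} (D : T -> Prop) (code : T -> nat)
    (Q : T -> Prop) (P : program) : Prop :=
  forall t, D t ->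
    (Q t -> halts_with P (code t) 1%N) /\ (~ Q t -> halts_with P (code t) 0%N).

Definition decidable_on {T : Type} (D : T -> Prop) (code : T -> nat)
    (Q : T -> Prop) : Prop :=
  exists P : program, decides_on D code Q P.

Definition code_int (z : int) : nat :=
  match z with Posz n => n.*2 | Negz n => n.*2.+1 end.

(* bijective pairing nat * nat -> nat *)
Definition npair (a b : nat) : nat := (2 ^ a * b.*2.+1).-1.

Fixpoint code_seq (s : seq nat) : nat :=
  if s is x :: s' then (npair x (code_seq s')).+1 else 0%N.

Definition code_mx (M : 'M[int]_4) : nat :=
  code_seq [seq code_int (M i j) | i <- enum 'I_4, j <- enum 'I_4].

Definition code_gens (gens : seq 'M[int]_4) : nat := code_seq (map code_mx gens).

Definition identity_in_semigroup (gens : seq 'M[int]_4) : Prop :=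
  exists s : seq 'M[int]_4,
    [/\ s != [::], all (fun M => M \in gens) s & (\prod_(M <- s) M = 1%:M)%R].

(* Main.v *)
Require Import Defs.
From HB Require Import structures.
From mathcomp Require Import all_boot all_order all_algebra.
From mathcomp Require Import zify ring.
Set Implicit Arguments. Unset Strict Implicit. Unset Printing Implicit Defensive.
Import Order.TTheory GRing.Theory Num.Theory.

(** The integer matrices used are block diagonal, with two blocks in a free subgroup of
    SL2(Z), so the question becomes whether (1, 1) is a product of given pairs of free group words.

    A Minsky machine is turned into a generalised Collatz function on Goedel numbers, and this
    into a tag system over six letters which deletes M letters at a time.  The table of the
    Collatz function is an array with M rows written as a single long appendant; since only
    every M-th letter is read, the offset of the reading head, which is determined by the
    residue of the current number, selects one row.  Hence the program only affects the
    lengths of the words, never the number of letters.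

    A halting run x_1, ..., x_T is the same as a word Z = w app(x_1) ... app(x_T) of length M T
    whose letter at position M i is x_(i+1).  The first components of the generators force that
    the sequence of tag letters pushed on one side is the one popped on the other side; the
    second components compare both expressions of Z.  Heights with respect to an extra letter p
    force all pushes to precede all pops.

    Each attempted run is closed by a loop generator carrying t^(-1) or t^4 in both components.
    In a product equal to the identity a vanishing power of t uses a multiple of five loops, so
    in each component at most 2/5 of the runs are nontrivial; some run is therefore trivial in
    both components, i.e. is a genuine halting run.

    Finally, the diagonal argument needs no universal machine: the program only enters the last
    eight matrices, the input only the first one, and the code of the whole list is an explicit
    elementary function of the input and of the code x of the last eight matrices.  A machine
    that feeds this value to a putative decision procedure and halts iff the answer is negative
    is run on its own x. *)

(** * A free subgroup of SL2(Z) *)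

Definition letter := (nat * bool)%type.
Definition linv (l : letter) : letter := (l.1, ~~ l.2).
Definition winv (w : seq letter) : seq letter := rev (map linv w).

Lemma linvK : involutive linv.
Proof. by case=> j b; rewrite /linv /= negbK. Qed.

Section FreeGroup.
Local Open Scope ring_scope.

(** The size 5 makes the ping-pong estimate strict: for [u] nonzero, [|y| <= 2|u|] gives
    [|y + 5u| >= 3|u| > 2|u|], and likewise for -5. *)
Definition lsgn (l : letter) : int := if l.2 then 5 else - 5%:Z.

(* The parabolic element with lower left entry [s] fixing the point [j] of the projective line. *)
Definition pmat (j : nat) (s : int) : 'M[int]_2 :=
  \matrix_(r, c)
    if r == 0 then (if c == 0 then 1 + s * j%:Z else - (s * j%:Z * j%:Z))
    else (if c == 0 then s else 1 - s * j%:Z).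

Lemma pmatD j s s' : pmat j s * pmat j s' = pmat j (s + s').
Proof.
apply/matrixP=> r c; rewrite !mxE !big_ord_recl big_ord0 !mxE /=.
by case: r => [[|[|//]] Hr]; case: c => [[|[|//]] Hc]; rewrite /eq_op /=; ring.
Qed.

Lemma pmat0 j : pmat j 0 = 1.
Proof.
apply/matrixP=> r c; rewrite !mxE.
by case: r => [[|[|//]] Hr]; case: c => [[|[|//]] Hc]; rewrite /eq_op /=; ring.
Qed.

Definition lmat (l : letter) : 'M[int]_2 := pmat l.1 (lsgn l).

Definition wmat (w : seq letter) : 'M[int]_2 := \prod_(l <- w) lmat l.

Lemma wmat_nil : wmat [::] = 1.
Proof. by rewrite /wmat big_nil. Qed.

Lemma wmat_cons l w : wmat (l :: w) = lmat l * wmat w.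
Proof. by rewrite /wmat big_cons. Qed.

Lemma wmat_cat u v : wmat (u ++ v) = wmat u * wmat v.
Proof. by rewrite /wmat big_cat. Qed.

Lemma wmat1 l : wmat [:: l] = lmat l.
Proof. by rewrite wmat_cons wmat_nil mulr1. Qed.

Lemma lmatK l : lmat l * lmat (linv l) = 1.
Proof.
by rewrite pmatD -(pmat0 l.1); congr pmat; case: l => j [].
Qed.

Lemma wmatKr w : wmat w * wmat (winv w) = 1.
Proof.
elim: w => [|l w IH]; first by rewrite wmat_nil mulr1.
rewrite wmat_cons /winv map_cons rev_cons -cats1 wmat_cat wmat1.
by rewrite mulrA -(mulrA (lmat l)) IH mulr1 lmatK.
Qed.

Lemma winvK : involutive winv.
Proof.
move=> w; rewrite /winv map_rev revK -map_comp -[RHS]map_id.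
by apply: eq_map => l /=; rewrite linvK.
Qed.

Lemma wmatKl w : wmat (winv w) * wmat w = 1.
Proof. by rewrite -{2}(winvK w) wmatKr. Qed.

Definition act (l : letter) (v : int * int) : int * int :=
  let u := v.1 - l.1%:Z * v.2 in
  let y := v.2 + lsgn l * u in (u + l.1%:Z * y, y).

Definition vec (v : int * int) : 'cV[int]_2 := \col_i if i == 0 then v.1 else v.2.

Lemma lmat_vec l v : lmat l *m vec v = vec (act l v).
Proof.
apply/matrixP=> r c; rewrite !mxE !big_ord_recl big_ord0 !mxE /=.
by case: r => [[|[|//]] Hr]; rewrite /eq_op /=; ring.
Qed.

Lemma wmat_vec w v : wmat w *m vec v = vec (foldr act v w).
Proof.
elim: w => [|l w IH] /=; first by rewrite wmat_nil mul1mx.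
by rewrite wmat_cons -mulmxA IH lmat_vec.
Qed.

Lemma vec_inj : injective vec.
Proof.
move=> [a b] [c d] /matrixP H; have := H 0 0; have := H 1 0.
by rewrite !mxE /= => -> ->.
Qed.

(** The attracting set of [l]: [|y| > 2|u|] with [u] nonzero, the sign of [u y] being that of
    [l]. *)
Definition region (l : letter) (v : int * int) : Prop :=
  let u := v.1 - l.1%:Z * v.2 in
  if l.2 then (0 < u /\ u + u < v.2) \/ (u < 0 /\ v.2 < u + u)
  else (0 < u /\ v.2 < - (u + u)) \/ (u < 0 /\ - (u + u) < v.2).

(** Passing to another index [i] changes [u] by [(i - j) y], of size at least [|y| > 2|u|], so the
    new [u] exceeds [|y| / 2] in size. *)
Lemma region_sep j b (l : letter) v : region (j, b) v -> l.1 != j ->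
  let u := v.1 - l.1%:Z * v.2 in
  (v.2 != 0) /\ (`|v.2| <= `|u| + `|u|).
Proof.
case: l => i c; case: v => x y; rewrite /region /= => H ne.
set u := x - j%:Z * y in H.
have Hu : `|u| + `|u| < `|y| by case: b H => H; lia.
have Hd : `|y| <= `|(i%:Z - j%:Z) * y|.
  by rewrite normrM ler_peMl //; lia.
have E : x - i%:Z * y = u - (i%:Z - j%:Z) * y by rewrite /u; ring.
rewrite E; split; lia.
Qed.

Lemma region_act (l : letter) (v : int * int) :
  let u := v.1 - l.1%:Z * v.2 in
  u != 0 -> (`|v.2| <= `|u| + `|u|) \/ region l v -> region l (act l v).
Proof.
case: l v => j b [x y]; rewrite /region /act /=.
set u := x - j%:Z * y => un0 H.
have -> : u + j%:Z * (y + lsgn (j, b) * u) - j%:Z * (y + lsgn (j, b) * u) = u by ring.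
by case: b H => /=; rewrite /lsgn /=; lia.
Qed.

Definition reduced (w : seq letter) := sorted (fun l l' => l' != linv l) w.

(** The start [(1, 2)] lies in no region, since [|1 - 2j| >= 1]. A repeated letter stays in its
    region, a letter of another index enters its own by [region_sep], and the inverse letter is
    excluded by reducedness. *)
Lemma pingpong l w : reduced (l :: w) -> region l (foldr act (1, 2%:Z) (l :: w)).
Proof.
elim: w l => [|l' w IH] l.
  by move=> _; case: l => j b; apply: region_act => /=; [|left]; lia.
rewrite /reduced => /= /andP[ne red].
have R := IH l' red.
change (region l (act l (foldr act (1, 2%:Z) (l' :: w)))).
move: (foldr act (1, 2%:Z) (l' :: w)) R => v R {IH}.
case: (eqVneq l.1 l'.1) => E.
  have El : l' = l.
    case: l l' E ne {red R} => j b [j' b'] /= ->; rewrite /linv /eq_op /= eqxx /=.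
    by case: b; case: b'.
  rewrite El in R; apply: region_act => /=; last by right.
  by move: R; rewrite /region /=; case: (l.2) => -[] []; lia.
case: l' R E {ne red} => j b R E.
have [y0 Hy] := region_sep R E.
apply: region_act => /=; last by left.
by apply/eqP => U0; move: Hy y0; rewrite /= U0; lia.
Qed.

Lemma reduced_neq1 w : reduced w -> w != [::] -> wmat w != 1.
Proof.
case: w => // l w red _; apply/eqP => E.
have R := pingpong red.
have := wmat_vec (l :: w) (1, 2%:Z); rewrite E mul1mx => /vec_inj F.
by move: R; rewrite -F /region /=; case: (l.2); lia.
Qed.

Definition redc (l : letter) (s : seq letter) : seq letter :=
  if s is l' :: s' then if l' == linv l then s' else l :: s else [:: l].
Definition red (w : seq letter) := foldr redc [::] w.

Lemma reduced_red w : reduced (red w).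
Proof.
elim: w => // l w /=; case: (red w) => [|l' s] //= H.
case: ifP => [_|/negbT ne]; last by rewrite /reduced /= ne.
exact: path_sorted H.
Qed.

Lemma foldr_red (T : Type) (F : letter -> T -> T) z w :
  (forall l a, F l (F (linv l) a) = a) -> foldr F z (red w) = foldr F z w.
Proof.
move=> HF; elim: w => //= l w <-; case: (red w) => [|l' s] //=.
by case: eqP => // ->; rewrite HF.
Qed.

Lemma wmat_foldr w : wmat w = foldr (fun l A => lmat l * A) 1 w.
Proof. by elim: w => [|l w IH]; rewrite ?wmat_nil // wmat_cons IH. Qed.

Lemma wmat_red w : wmat (red w) = wmat w.
Proof.
rewrite !wmat_foldr foldr_red // => l A.
by rewrite mulrA lmatK mul1r.
Qed.

Lemma wmat1_red w : wmat w = 1 -> red w = [::].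
Proof.
move=> E; apply/eqP; apply: contraT => ne.
by have := reduced_neq1 (reduced_red w) ne; rewrite wmat_red E eqxx.
Qed.

(** A source of invariants: a word with trivial matrix freely reduces to the empty word, so it acts
    trivially in every action of the free group. Heights and exponent sums are such actions. *)
Lemma wmat1_foldr (T : Type) (F : letter -> T -> T) z w :
  (forall l a, F l (F (linv l) a) = a) -> wmat w = 1 -> foldr F z w = z.
Proof. by move=> HF /wmat1_red E; rewrite -(foldr_red z w HF) E. Qed.

Lemma mem_red l w : l \in red w -> l \in w.
Proof.
elim: w => //= l' w IH; rewrite inE.
case E: (red w) IH => [|l1 s] IH /=; first by rewrite inE => /eqP->; rewrite eqxx.
case: eqP => _.
  by move=> H; rewrite IH ?orbT // inE H orbT.
by rewrite inE => /orP[->//|/IH->]; rewrite orbT.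
Qed.

Lemma reduced_cat u v : reduced u -> reduced v ->
  (forall l l', l \in u -> ohead v = Some l' -> l' != linv l) -> reduced (u ++ v).
Proof.
case: u => //= l u; case: v => [|l' v]; first by rewrite cats0.
move=> Hu Hv H; rewrite /reduced /= cat_path /=.
by apply/and3P; split=> //; apply: H; rewrite ?mem_last.
Qed.

Definition pw (s : seq nat) : seq letter := [seq (j, true) | j <- s].

Lemma pw_cat u v : pw (u ++ v) = pw u ++ pw v.
Proof. exact: map_cat. Qed.

Lemma winv_pw s : winv (pw s) = [seq (k, false) | k <- rev s].
Proof. by rewrite /winv /pw -map_comp map_rev. Qed.

Lemma reduced_const b (s : seq nat) : reduced [seq (j, b) | j <- s].
Proof.
case: s => // j s; rewrite /reduced /=; elim: s j => //= j' s IH j.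
by rewrite IH andbT /linv /eq_op /=; case: b {IH}; rewrite andbF.
Qed.

(** Common first letters are stripped; once the first letters differ, [winv (pw v) ++ pw u] is
    already reduced, hence not trivial. *)
Lemma pw_inj u v : wmat (pw u) = wmat (pw v) -> u = v.
Proof.
elim: u v => [|i u IH] [|j v] //.
- by move=> E; have := reduced_neq1 (reduced_const true (j :: v)) isT; rewrite -/(pw _) -E wmat_nil eqxx.
- by move=> E; have := reduced_neq1 (reduced_const true (i :: u)) isT; rewrite -/(pw _) E wmat_nil eqxx.
case: (eqVneq i j) => [->|ne] E.
  have : wmat [:: (j, false)] * wmat (pw (j :: u)) = wmat [:: (j, false)] * wmat (pw (j :: v)).
    by rewrite E.
  rewrite /= !wmat_cons !wmat_nil !mulr1 !mulrA.
  by have := lmatK (j, false); rewrite /linv /= => ->; rewrite !mul1r => /IH->.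
have : reduced (winv (pw (j :: v)) ++ pw (i :: u)).
  rewrite winv_pw.
  rewrite rev_cons map_rcons -cats1 -catA; apply: reduced_cat.
  - exact: reduced_const.
  - rewrite /=; have /= := reduced_const true (i :: u).
    by rewrite /reduced /= /linv /eq_op /= ?andbT ne => ->.
  - by move=> l l' /mapP[k _ ->]; case=> <-; rewrite /linv /eq_op /= andbF.
move/reduced_neq1 => H; exfalso.
have /H : winv (pw (j :: v)) ++ pw (i :: u) != [::] by rewrite -size_eq0 size_cat addnS.
by rewrite wmat_cat E wmatKl eqxx.
Qed.

End FreeGroup.

Arguments reduced : simpl never.

(** * Nontrivial factors in a product with powers of a free letter *)

Section Counting.
Variable t : nat.
Local Open Scope ring_scope.

Definition tp (k : int) : seq letter :=
  match k with Posz n => nseq n (t, true) | Negz n => nseq n.+1 (t, false) end.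

Lemma wmat_nseq (l : letter) n : wmat (nseq n l) = pmat l.1 (lsgn l *+ n).
Proof.
elim: n => [|n IH]; first by rewrite wmat_nil mulr0n pmat0.
by rewrite /= wmat_cons IH pmatD mulrS.
Qed.

Lemma wmat_tp k : wmat (tp k) = pmat t (5 * k).
Proof. by case: k => n; rewrite wmat_nseq /=; congr pmat; rewrite /lsgn /= -mulr_natr; lia. Qed.

Lemma wmat_tpD k k' : wmat (tp k) * wmat (tp k') = wmat (tp (k + k')).
Proof. by rewrite !wmat_tp pmatD mulrDr. Qed.

Lemma tp_neq0 k : k != 0 -> exists b w, tp k = (t, b) :: w.
Proof. by case: k => [[|n]|n] // _; [exists true | exists false]; eexists. Qed.

Lemma mem_tp k l : l \in tp k -> l.1 = t /\ forall l', l' \in tp k -> l' = l.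
Proof.
case: k => n H.
  by move/nseqP: (H) => [-> _]; split=> // l' /nseqP[-> _].
by move/nseqP: (H) => [-> _]; split=> // l' /nseqP[-> _].
Qed.

Lemma reduced_tp k : reduced (tp k).
Proof.
suff H b n : reduced (nseq n (t, b)) by case: k => n; apply: H.
have -> : nseq n (t, b) = [seq (j, b) | j <- nseq n t] by rewrite map_nseq.
exact: reduced_const.
Qed.

Definition tfree (w : seq letter) := all (fun l => l.1 != t) w.

Lemma tfree_red w : tfree w -> tfree (red w).
Proof. by move/allP=> H; apply/allP => l /mem_red /H. Qed.

(* [sa] counts the nontrivial original factors merged into a slot, and [sb] the number of
   vanished blocks of [t]-powers which separated them. *)
Record slot := Slot { sw : seq letter; sa : nat; sb : nat }.
Definition item := (slot * (int * nat))%type.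

Definition iword (L : seq item) : seq letter :=
  flatten [seq sw i.1 ++ tp i.2.1 | i <- L].

Definition nontriv (i : item) := wmat (sw i.1) != 1.
Definition iok (i : item) := tfree (sw i.1) && (i.2.1 != 0).

(** Nontrivial [t]-free factors between nonzero powers of [t] cannot cancel. Keeping a leading
    letter [t] in the conclusion lets the induction extend to the left. *)
Lemma iword_tail k L w : k != 0 -> all iok L -> all nontriv L -> tfree w ->
  exists b v, reduced ((t, b) :: v) /\
              wmat ((t, b) :: v) = wmat (tp k ++ iword L ++ w).
Proof.
elim: L k => [|i L IH] k k0 /=.
  move=> _ _ tw; have [b [v Ev]] := tp_neq0 k0.
  exists b, (v ++ red w); rewrite -cat_cons -Ev; split; last by rewrite !wmat_cat wmat_red.
  apply: reduced_cat; [exact: reduced_tp | exact: reduced_red|].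
  move=> l l' /mem_tp[El _]; case E: (red w) => [|x s] // [<-].
  have /allP/(_ x) := tfree_red tw; rewrite E inE eqxx => /(_ isT) ne.
  by apply: contra ne => /eqP ->; rewrite /linv El.
move=> /andP[/andP[ti k'0] okL] /andP[ni nL] tw.
have [b' [v' [R' E']]] := IH _ k'0 okL nL tw.
have [b [v Ev]] := tp_neq0 k0.
have tr := tfree_red ti.
have nr : red (sw i.1) != [::].
  by apply: contraNneq ni => E; rewrite -wmat_red E wmat_nil.
exists b, (v ++ red (sw i.1) ++ (t, b') :: v'); rewrite -cat_cons -Ev; split; last first.
  by rewrite !wmat_cat wmat_red E' /iword /= !wmat_cat !mulrA.
apply: reduced_cat; [exact: reduced_tp | apply: reduced_cat => //; first exact: reduced_red|].
  move=> l l' Hl [<-]; have /allP/(_ _ Hl) ne := tr.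
  by apply: contra ne => /eqP E; have := congr1 fst E; rewrite /= => <-.
move=> l l' /mem_tp[El _]; case E: (red (sw i.1)) nr tr => [|x s] //= _ /andP[ne _] [<-].
by apply: contra ne => /eqP ->; rewrite /linv El.
Qed.

Lemma iword_neq1 i L w : iok i -> all iok L -> all nontriv L -> tfree w ->
  wmat (iword (i :: L) ++ w) != 1.
Proof.
move=> /andP[ti k0] okL nL tw.
have [b [v [R E]]] := iword_tail k0 okL nL tw.
rewrite /iword /= -!catA wmat_cat -/(iword L) -E -(wmat_red (sw i.1)) -wmat_cat.
apply: reduced_neq1; last by rewrite -size_eq0 size_cat addnS.
apply: reduced_cat => //; first exact: reduced_red.
move=> l l' Hl [<-]; have /allP/(_ _ Hl) ne := tfree_red ti.
by apply: contra ne => /eqP F; have := congr1 fst F; rewrite /= => <-.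
Qed.

(** A slot merges at most [sb + 1] nontrivial factors. A trivial slot contains none if [sb = 0], and
    otherwise [sb + 1 <= 2 sb]. *)
Definition sinv (s : slot) : Prop :=
  [/\ tfree (sw s), (sa s <= (sb s).+1)%N & wmat (sw s) = 1 -> (sa s <= (sb s).*2)%N].

(** Exponents start as -1 or 4, so an exponent plus the number of powers merged into it stays a
    multiple of 5. *)
Definition iinv (i : item) : Prop :=
  [/\ sinv i.1, i.2.1 != 0, (0 < i.2.2)%N & exists z : int, i.2.1 + i.2.2%:Z = 5 * z].

Definition smul (s s' : slot) := Slot (sw s ++ sw s') (sa s + sa s') (sb s + sb s').+1.

Lemma sinv_mul s s' : sinv s -> sinv s' -> sinv (smul s s').
Proof.
case: s => w a b; case: s' => w' a' b' [/= T1 A1 _] [/= T2 A2 _]; split => //=.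
- by rewrite /tfree all_cat; apply/andP.
- lia.
- by move=> _; lia.
Qed.

Fixpoint iforall (P : item -> Prop) (L : seq item) : Prop :=
  if L is i :: L' then P i /\ iforall P L' else True.

Lemma iforall_cat P L1 L2 : iforall P (L1 ++ L2) <-> iforall P L1 /\ iforall P L2.
Proof. by elim: L1 => [|i L1 IH] /=; [split=> [|[]]|rewrite IH; tauto]. Qed.

Definition suma (L : seq item) := sumn [seq sa i.1 | i <- L].
Definition sumb (L : seq item) := sumn [seq sb i.1 | i <- L].
Definition summ (L : seq item) := sumn [seq i.2.2 | i <- L].

Lemma iword_cat L1 L2 : iword (L1 ++ L2) = iword L1 ++ iword L2.
Proof. by rewrite /iword map_cat flatten_cat. Qed.

Lemma iinv_ok L : iforall iinv L -> all iok L.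
Proof. by elim: L => //= i L IH [[[T _ _] k0 _ _] /IH ->]; rewrite /iok T k0. Qed.

Lemma has_split (A : Type) (a : pred A) (L : seq A) : ~~ all a L ->
  exists L1 x L2, L = L1 ++ x :: L2 /\ ~~ a x.
Proof.
elim: L => //= x L IH; case ax: (a x) => /=.
  by move/IH => [L1 [y [L2 [-> ny]]]]; exists (x :: L1), y, L2.
by move=> _; exists [::], x, L; rewrite ax.
Qed.

(** By [iword_neq1] some slot other than the two outermost is trivial, so the powers of [t] around
    it meet. Either they merge into one nonzero power, or they cancel and the two adjacent slots
    merge; the at least five original powers lost then pay for one more vanished block. *)
Lemma count_bound n L s : (size L <= n)%N -> iforall iinv L -> sinv s ->
  wmat (iword L ++ sw s) = 1 ->
  (5 * (suma L + sa s) <= 2 * (summ L + 5 * (sumb L + sb s)))%N.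
Proof.
elim: n L s => [|n IH] L s Hn HL Hs HW.
  by case: L Hn HL HW => // _ _; case: Hs => _ _ H /H /=; rewrite /suma /summ /sumb /=; lia.
case: L Hn HL HW => [|i L] Hn HL HW.
  by case: Hs => _ _ H; move/H: HW; rewrite /suma /summ /sumb /=; lia.
have okiL := iinv_ok HL.
case nL : (all nontriv L).
  case/andP: okiL => oki okL; have [Ts _ _] := Hs.
  by have := iword_neq1 oki okL nL Ts; rewrite HW eqxx.
have [L1 [j [L2 [EL /negPn/eqP triv]]]] := has_split (negbT nL).
have {EL} [L1' [[sp [k m]] EL]] : exists L1' p, i :: L = L1' ++ [:: p, j & L2].
  exists (belast i L1), (last i L1).
  by rewrite EL -cat_cons lastI cat_rcons.
case: j EL triv => sj [k' m'] EL /= triv.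
rewrite EL in HL HW Hn *.
have {HL} [H1 [[isp k0 m0 [z Hz]] [[isj k'0 m'0 [z' Hz']] H2]]] := (iforall_cat _ _ _).1 HL.
have HW' : wmat (iword L1' ++ sw sp ++ tp (k + k') ++ iword L2 ++ sw s) = 1.
  rewrite -HW iword_cat /iword /= !wmat_cat triv mul1r !mulrA.
  by congr (_ * _ * _); rewrite -!mulrA wmat_tpD.
have Hj : (sa sj <= (sb sj).*2)%N by case: isj => _ _; apply.
case: (eqVneq (k + k') 0) => [kk|kk].
  (* Both [k + m] and [k' + m'] are multiples of 5 and [k + k' = 0], so the positive number [m + m']
     is a multiple of 5. *)
  have Hm : (5 <= m + m')%N by move: Hz Hz' m0 => /=; lia.
  rewrite kk /= in HW'.
  case: L2 H2 HW' Hn {HW EL} => [|[s2 [k2 m2]] L2] /=.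
    move=> _ HW' Hn.
    have := IH L1' (smul sp s) _ H1 (sinv_mul isp Hs) HW'.
    rewrite size_cat /= in Hn.
    move/(_ ltac:(lia)); rewrite /suma /summ /sumb !map_cat !sumn_cat /=; lia.
  move=> [[is2 k20 m20 Hz2] H2] HW' Hn.
  have := IH (L1' ++ (smul sp s2, (k2, m2)) :: L2) s _ _ Hs.
  rewrite size_cat /= in Hn.
  rewrite size_cat /=; move/(_ ltac:(lia)).
  have HI : iforall iinv (L1' ++ (smul sp s2, (k2, m2)) :: L2).
    by apply/iforall_cat; split=> //; split=> //; split=> //; apply: sinv_mul.
  move/(_ HI); rewrite iword_cat /iword /= -!catA; move: HW'; rewrite /iword /= -!catA => HW'.
  by move/(_ HW'); rewrite /suma /summ /sumb !map_cat !sumn_cat /=; lia.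
have HI : iforall iinv (L1' ++ (sp, ((k + k')%R, (m + m')%N)) :: L2).
  apply/iforall_cat; split=> //; split=> //; split=> //=; first by rewrite addn_gt0 m0.
  by exists (z + z'); rewrite PoszD mulrDr -Hz -Hz' /=; ring.
have := IH _ s _ HI Hs.
rewrite size_cat /= in Hn.
rewrite size_cat /=; move/(_ ltac:(lia)).
rewrite iword_cat /iword /= -!catA => /(_ HW').
by rewrite /suma /summ /sumb !map_cat !sumn_cat /=; lia.
Qed.

Lemma count_nontrivial (L : seq (seq letter * int)) :
  all (fun p => tfree p.1) L -> all (fun p => (p.2 == -1) || (p.2 == 4)) L ->
  wmat (flatten [seq p.1 ++ tp p.2 | p <- L]) = 1 ->
  (5 * count (fun p => wmat p.1 != 1%R) L <= 2 * size L)%N.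
Proof.
move=> HT HK HW.
pose f (p : seq letter * int) : item := (Slot p.1 (wmat p.1 != 1) 0, (p.2, 1%N)).
have HI : iforall iinv (map f L).
  elim: L HT HK {HW} => //= [[w k] L] IH /andP[/= tw HT] /andP[/= Hk HK].
  split; last exact: IH.
  split => //=; last by case/orP: Hk => /eqP ->; [exists 0 | exists 1].
    split=> //=; first by case: (_ != _).
    by move=> ->; rewrite eqxx.
  by case/orP: Hk => /eqP ->.
have := count_bound (leqnn _) HI (s := Slot [::] 0 0).
have -> : suma (map f L) = count (fun p => wmat p.1 != 1%R) L.
  by rewrite /suma -map_comp -sumn_count; congr sumn; apply: eq_map.
have -> : summ (map f L) = size L.
  by rewrite /summ; elim: (L) => //= p L' ->.
have -> : sumb (map f L) = 0%N by rewrite /sumb; elim: (L) => //= p L' ->.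
rewrite /= !addn0; apply; first by split.
by rewrite cats0 -HW /iword -map_comp; congr (wmat (flatten _)); apply: eq_map.
Qed.

End Counting.

(** * Tag equations as products of pairs of words *)

(** [GI] is an input marker, [GPopK] pops a letter that the tag system reads, [GPopD] one that it
    deletes unread, [GTurn] separates pushes from pops, and [GLoop] closes a run. *)
Inductive gen := GI | GPush of nat | GTurn | GPopK of nat | GPopD of nat | GLoop of bool.

Definition gok g := match g with GPush x | GPopK x | GPopD x => x < 6 | _ => true end.
Definition gloop g := if g is GLoop _ then true else false.
Definition gturn g := if g is GTurn then true else false.
Definition gpop g := match g with GPopK _ | GPopD _ => true | _ => false end.
Definition gpush g := match g with GI | GPush _ => true | _ => false end.

Lemma flatten_nseq (T : Type) n m (x : T) : flatten (nseq n (nseq m x)) = nseq (n * m) x.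
Proof. by elim: n => //= n ->; rewrite mulSn nseqD. Qed.

Lemma flatten_cons (T : Type) (s : seq T) ss : flatten (s :: ss) = s ++ flatten ss.
Proof. by []. Qed.

Section Encoding.
Variables (M : nat) (app : nat -> seq nat) (S X : nat) (pre : seq nat).
Hypothesis M_gt0 : 0 < M.

Definition tagsol (w0 xs : seq nat) : Prop :=
  let Z := w0 ++ flatten (map app xs) in
  size Z = M * size xs /\ forall i, i < size xs -> nth 0 Z (M * i) = nth 0 xs i.

(* Letters of the first component: 0 to 5 are the tag letters, 6 fills the deleted positions,
   7 marks the input, 8 is the height letter p, and 9 is t.  Second component: 0 to 5 are the
   tag letters and 6 is t. *)
Definition kloop (b : bool) : int := (if b then 4 else -1)%R.

Definition e1 : seq letter := (8, true) :: nseq S (7, false).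
Definition e2 : seq letter := pw pre.

Definition w1 (g : gen) : seq letter :=
  match g with
  | GI => [:: (7, true)]
  | GPush x => pw (x :: nseq M.-1 6)
  | GTurn => [:: (8, false)]
  | GPopK x => [:: (8, true); (x, false); (8, false)]
  | GPopD x => [:: (8, true); (6, false); (8, false)]
  | GLoop b => e1 ++ tp 9 (kloop b)
  end.

Definition w2 (g : gen) : seq letter :=
  match g with
  | GI => pw (nseq X 0)
  | GPush x => pw (app x)
  | GTurn => [::]
  | GPopK x | GPopD x => [:: (x, false)]
  | GLoop b => e2 ++ tp 6 (kloop b)
  end.

Definition ww1 (gs : seq gen) := flatten (map w1 gs).
Definition ww2 (gs : seq gen) := flatten (map w2 gs).

Lemma ww1_cat u v : ww1 (u ++ v) = ww1 u ++ ww1 v.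
Proof. by rewrite /ww1 map_cat flatten_cat. Qed.
Lemma ww2_cat u v : ww2 (u ++ v) = ww2 u ++ ww2 v.
Proof. by rewrite /ww2 map_cat flatten_cat. Qed.

Section Heights.
Local Open Scope ring_scope.
Variable k : int.

Definition sgb (b : bool) : int := if b then 1 else - 1%:Z.

(* Signed count of the letters other than [8] whose height, the exponent sum of [8] to their
   right, is [k]. *)
Definition hstep (l : letter) (a : int * int) : int * int :=
  if l.1 == 8 then (a.1, a.2 + sgb l.2)
  else (a.1 + sgb l.2 * (a.2 == k)%:Z, a.2).

Lemma hstepK l a : hstep l (hstep (linv l) a) = a.
Proof.
case: l a => j b [c h]; rewrite /hstep /linv /=.
case: (j == 8); case: b; congr (_, _) => /=; rewrite /sgb; lia.
Qed.

Definition hcount (g : gen) : int * int :=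
  match g with GPush _ => (M%:Z, 0) | GI => (1, 0)
  | GPopK _ | GPopD _ => (0, 1) | _ => (0, 0) end.

Lemma hstep_nseq n j b a : j != 8%N ->
  foldr hstep a (nseq n (j, b)) = (a.1 + n%:Z * (sgb b * (a.2 == k)%:Z), a.2).
Proof.
move=> j8; elim: n => [|n IH] /=; first by case: a => c h /=; rewrite mul0r addr0.
rewrite IH {1}/hstep /= (negbTE j8); congr (_, _).
by rewrite -addrA; congr (_ + _); rewrite intS mulrDl mul1r addrC.
Qed.

(** Pushes and input markers count at the height to their right, pops one below because of their own
    [p^(-1)]; only [GTurn] changes the height. *)
Lemma hstep_gen g a : gok g -> ~~ gloop g ->
  foldr hstep a (w1 g) =
  (a.1 + (hcount g).1 * (a.2 == k)%:Z - (hcount g).2 * (a.2 - 1 == k)%:Z, a.2 - (gturn g)%:Z).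
Proof.
case: a => c h; case: g => [|x||x|x|b] // ok _.
- by rewrite /= /hstep /= /sgb !mul1r mul0r !subr0.
- have x8 : (x == 8) = false by move: ok => /=; lia.
  rewrite /w1 /pw [map _ _]/= map_nseq /= hstep_nseq // /hstep /= x8 /sgb !mul1r mul0r !subr0.
  congr (_, _); rewrite -addrA; congr (_ + _).
  have -> : M%:Z = M.-1%:Z + 1 by lia.
  by rewrite mulrDl mul1r.
- by rewrite /= /hstep /= /sgb !mul0r subr0 addr0.
- have x8 : (x == 8) = false by move: ok => /=; lia.
  by rewrite /= /hstep /= x8 /sgb /= mul0r mul1r addr0 mulN1r subrK subr0.
- by rewrite /= /hstep /= /sgb /= mul0r mul1r addr0 mulN1r subrK subr0.
Qed.

Definition hsum (U : seq gen) : int * int :=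
  (\sum_(g <- U) (hcount g).1, \sum_(g <- U) (hcount g).2).

Lemma hstep_noturn U a : all gok U -> ~~ has gloop U -> ~~ has gturn U ->
  foldr hstep a (ww1 U) =
  (a.1 + (hsum U).1 * (a.2 == k)%:Z - (hsum U).2 * (a.2 - 1 == k)%:Z, a.2).
Proof.
rewrite /hsum; elim: U => [|g U IH] /=.
  by rewrite !big_nil !mul0r subr0 addr0; case: a.
move=> /andP[okg okU]; rewrite !negb_or => /andP[lg lU] /andP[tg tU].
rewrite /ww1 /= foldr_cat -/(ww1 U) IH // hstep_gen //= (negbTE tg) subr0 !big_cons.
by congr (_, _); ring.
Qed.

End Heights.

Lemma height_turn k U a : all gok U -> ~~ has gloop U ->
  (foldr (hstep k) a (ww1 U)).2 = (a.2 - (count gturn U)%:Z)%R.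
Proof.
elim: U => [|g U IH] /=; first by rewrite subr0.
move=> /andP[okg okU]; rewrite negb_or => /andP[lg lU].
rewrite /ww1 /= foldr_cat -/(ww1 U) hstep_gen //= IH //; lia.
Qed.

Lemma hsum1_eq0 U : (hsum U).1 = 0%R -> ~~ has gpush U.
Proof.
move=> H; apply/negP => /(has_nthP GTurn)[i Hi Hg].
have : (0 < (hsum U).1)%R; last by rewrite H.
rewrite /hsum /= (big_nth GTurn) (bigD1_seq i) ?mem_index_iota ?iota_uniq //=.
apply: ltr_wpDr; last by case: (nth _ _ _) Hg.
by apply: sumr_ge0 => j _; case: (nth _ _ _).
Qed.

Lemma hsum2_eq0 U : (hsum U).2 = 0%R -> ~~ has gpop U.
Proof.
move=> H; apply/negP => /(has_nthP GTurn)[i Hi Hg].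
have : (0 < (hsum U).2)%R; last by rewrite H.
rewrite /hsum /= (big_nth GTurn) (bigD1_seq i) ?mem_index_iota ?iota_uniq //=.
apply: ltr_wpDr; last by case: (nth _ _ _) Hg.
by apply: sumr_ge0 => j _; case: (nth _ _ _).
Qed.

(** The exponent of [p] is minus the number of turns, so there is no turn. Then all pushes sit at
    height 0 and all pops at height -1, so they cannot cancel each other. *)
Lemma noloop_trivial U : all gok U -> ~~ has gloop U -> wmat (ww1 U) = 1%R -> U = [::].
Proof.
move=> okU lU HW.
have Hf k : foldr (hstep k) (0, 0)%R (ww1 U) = (0, 0)%R.
  by apply: wmat1_foldr HW => l a; apply: hstepK.
have tU : ~~ has gturn U.
  have := height_turn 0%R (0, 0)%R okU lU; rewrite Hf /= has_count; lia.
have H1 : ~~ has gpush U.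
  apply: hsum1_eq0; have := Hf 0%R; rewrite hstep_noturn //= => -[]; lia.
have H2 : ~~ has gpop U.
  apply: hsum2_eq0; have := Hf (-1)%R; rewrite hstep_noturn //= => -[]; lia.
case: U lU tU H1 H2 {okU HW Hf} => // g U /=.
by rewrite !negb_or; case: g.
Qed.

Definition yl g := match g with GPopK x => x | _ => 6 end.
Definition zl g := match g with GPopK x | GPopD x => x | _ => 0 end.
Definition a1 g := match g with GI => [:: 7] | GPush x => x :: nseq M.-1 6 | _ => [::] end.
Definition a2 g := match g with GI => nseq X 0 | GPush x => app x | _ => [::] end.

Lemma ww1_push U : all gpush U -> ww1 U = pw (flatten (map a1 U)).
Proof.
elim: U => //= g U IH /andP[Hg HU]; rewrite /ww1 /= -/(ww1 U) pw_cat IH //.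
by congr (_ ++ _); case: g Hg.
Qed.

Lemma ww2_push U : all gpush U -> ww2 U = pw (flatten (map a2 U)).
Proof.
elim: U => //= g U IH /andP[Hg HU]; rewrite /ww2 /= -/(ww2 U) pw_cat IH //.
by congr (_ ++ _); case: g Hg.
Qed.

Lemma ww2_pop U : all gpop U -> ww2 U = winv (pw (rev (map zl U))).
Proof.
rewrite winv_pw revK; elim: U => //= g U IH /andP[Hg HU].
by rewrite /ww2 /= -/(ww2 U) IH //; case: g Hg.
Qed.

Lemma lmatK' j b : (lmat (j, b) * lmat (j, ~~ b) = 1)%R.
Proof. exact: (lmatK (j, b)). Qed.

Lemma wmat_pop U : all gpop U ->
  wmat (ww1 U) = (lmat (8, true) * wmat (winv (pw (rev (map yl U)))) * lmat (8, false))%R.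
Proof.
rewrite winv_pw revK; elim: U => [|g U IH] /=.
  by rewrite wmat_nil mulr1 (lmatK' 8 true).
move=> /andP[Hg HU]; rewrite /ww1 /= -/(ww1 U) wmat_cat IH // wmat_cons.
have -> : wmat (w1 g) = (lmat (8, true) * lmat (yl g, false) * lmat (8, false))%R.
  by case: g Hg => //= x _; rewrite !wmat_cons wmat_nil mulr1 mulrA.
rewrite -!mulrA; congr (_ * (_ * _))%R.
by rewrite mulrA (lmatK' 8 false) mul1r.
Qed.

Lemma parse_push n U ys : all gok U -> all gpush U -> all (fun y => y < 7) ys ->
  flatten (map a1 U) = nseq n 7 ++ ys -> exists xs, U = nseq n GI ++ map GPush xs.
Proof.
elim: n U => [|n IH] U /= okU pU Hy.
  elim: U ys okU pU Hy => [|g U IH] ys /=; first by exists [::].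
  move=> /andP[okg okU] /andP[pg pU] Hy E.
  have Hy' : all (fun y => y < 7) (flatten (map a1 U)).
    by move: Hy; rewrite -E all_cat => /andP[].
  have [xs ->] := IH _ okU pU Hy' erefl.
  case: g okg pg E => //= [_ _ E|x _ _ _]; first by move: Hy; rewrite -E.
  by exists (x :: xs).
case: U okU pU => // -[|x||x|x|b] U //=.
  by move=> okU pU [E]; have [xs ->] := IH _ okU pU Hy E; exists xs.
by move=> /andP[okx _] _ [Ex]; rewrite Ex in okx.
Qed.

Definition ychunks xs := flatten [seq x :: nseq M.-1 6 | x <- xs].

Lemma size_ychunks xs : size (ychunks xs) = M * size xs.
Proof.
elim: xs => [|x xs IH]; first by rewrite muln0.
by rewrite /ychunks /= size_cat -/(ychunks xs) IH size_nseq; lia.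
Qed.

Lemma nth_ychunks xs j : j < M * size xs ->
  nth 0 (ychunks xs) j = if M %| j then nth 0 xs (j %/ M) else 6.
Proof.
elim: xs j => [|x xs IH] j /=; first by rewrite muln0.
rewrite mulnS => Hj; rewrite /ychunks [flatten _]/= -/(ychunks xs) -cat_cons nth_cat.
rewrite [size _]/= size_nseq prednK //; case: (ltnP j M) => jM.
  rewrite divn_small //; case: j jM {Hj} => [|j] jM; first by rewrite dvdn0.
  by rewrite gtnNdvd //= nth_nseq ifT //; lia.
rewrite -(subnK jM); set i := j - M; rewrite addnK IH; last by lia.
by rewrite dvdn_addl ?dvdnn // divnDr ?dvdnn // divnn M_gt0 addn1.
Qed.

(* The letter counts at heights 1 and -1 exclude pushes after the turn and pops before it. *)
Lemma trivial_block U : all gok U -> ~~ has gloop U ->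
  wmat (ww1 U ++ e1) = 1%R -> wmat (ww2 U ++ e2) = 1%R ->
  exists xs, tagsol (pre ++ nseq (S * X) 0) xs.
Proof.
move=> okU lU HW1 HW2.
have Hf k : foldr (hstep k) (0, 0)%R (ww1 U ++ e1) = (0, 0)%R.
  by apply: wmat1_foldr HW1 => l a; apply: hstepK.
have He k : foldr (hstep k) (0, 0)%R e1 = (- S%:Z * (0 == k)%:Z, 1)%R.
  rewrite /e1 /= hstep_nseq //= /hstep /= /sgb /=; congr (_, _).
  by rewrite add0r mulN1r mulrN mulNr.
(* [e1] adds 1 to the exponent of [p] and each turn subtracts 1, so there is exactly one turn. *)
have /has_split [al [g [be [EU Hg]]]] : ~~ all (predC gturn) U.
  rewrite all_predC negbK has_count; have := Hf 0%R; rewrite foldr_cat He.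
  by move/(congr1 snd); rewrite height_turn //=; lia.
case: g EU Hg => // EU _.
have cU : count gturn U = 1.
  have := Hf 0%R; rewrite foldr_cat He.
  by move/(congr1 snd); rewrite height_turn //=; lia.
move: okU lU cU; rewrite EU all_cat has_cat count_cat /= negb_or.
move=> /andP[oka okb] /andP[la lb] cU.
have ta : ~~ has gturn al by rewrite has_count; lia.
have tb : ~~ has gturn be by rewrite has_count; lia.
have Hs (k : int) : (- S%:Z * (0 == k)%:Z + (hsum be).1 * (1 == k)%:Z - (hsum be).2 * (0 == k)%:Z
     + (hsum al).1 * (0 == k)%:Z - (hsum al).2 * (-1 == k)%:Z = 0)%R.
  have := Hf k; rewrite foldr_cat He EU.
  have -> : ww1 (al ++ GTurn :: be) = ww1 al ++ (8, false) :: ww1 be by rewrite ww1_cat.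
  rewrite foldr_cat [foldr _ _ (_ :: _)]/= (hstep_noturn k _ okb) // {1}/hstep /=.
  by rewrite hstep_noturn //= => /(congr1 fst); apply.
have pb : all gpop be.
  have Hp : ~~ has gpush be by apply: hsum1_eq0; have := Hs 1%R; lia.
  elim: (be) lb tb Hp => //= g V IH; rewrite !negb_or.
  by move=> /andP[l1 ?] /andP[t1 ?] /andP[p1 ?]; rewrite IH // andbT; case: g l1 t1 p1.
have pa : all gpush al.
  have Hp : ~~ has gpop al by apply: hsum2_eq0; have := Hs (-1)%R; lia.
  elim: (al) la ta Hp => //= g V IH; rewrite !negb_or.
  by move=> /andP[l1 ?] /andP[t1 ?] /andP[p1 ?]; rewrite IH // andbT; case: g l1 t1 p1.
have Ey : flatten (map a1 al) = nseq S 7 ++ rev (map yl be).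
  apply: pw_inj; rewrite -ww1_push //.
  move: HW1; rewrite EU ww1_cat /ww1 [flatten (map w1 (_ :: _))]/= -!/(ww1 _) /e1.
  rewrite wmat_cat wmat_cat !wmat_cons (wmat_pop pb).
  set A := wmat (ww1 al); set B := wmat (winv _).
  have -> : nseq S (7, false) = winv (pw (nseq S 7)) by rewrite winv_pw rev_nseq map_nseq.
  set C := wmat (winv _).
  have p1 := lmatK' 8 true; have p2 := lmatK' 8 false; rewrite /= in p1 p2.
  rewrite (_ : (_ * _ * _ = A * B * C)%R); last first.
    rewrite -!mulrA; congr (_ * _)%R.
    by rewrite mulrA p2 mul1r; congr (_ * _)%R; rewrite mulrA p2 mul1r.
  move=> E; rewrite pw_cat wmat_cat.
  have BK : (B * wmat (pw (rev (map yl be))) = 1)%R by apply: wmatKl.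
  have CK : (C * wmat (pw (nseq S 7)) = 1)%R by apply: wmatKl.
  by rewrite -[A]mulr1 -BK mulrA; congr (_ * _)%R; rewrite -[LHS]mulr1 -CK mulrA E mul1r.
have Ez : pre ++ flatten (map a2 al) = rev (map zl be).
  apply: pw_inj; rewrite pw_cat wmat_cat -ww2_push //.
  move: HW2; rewrite EU ww2_cat /ww2 [flatten (map w2 (_ :: _))]/= -!/(ww2 _) /e2.
  rewrite 2!wmat_cat (ww2_pop pb).
  set A := wmat (ww2 al); set B := wmat (winv _); set C := wmat (pw pre) => E.
  have BK : (wmat (pw (rev (map zl be))) * B = 1)%R by apply: wmatKr.
  have BK' : (B * wmat (pw (rev (map zl be))) = 1)%R by apply: wmatKl.
  (* A cyclic rotation brings [pre] from the end of the block to its front. *)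
  have CK : (C * (A * B) = 1)%R by apply: mulmx1C.
  by rewrite -[LHS]mulr1 -BK' mulrA -(mulrA C) CK mul1r.
have Hy7 : all (fun y => y < 7) (rev (map yl be)).
  by rewrite all_rev all_map; apply: sub_all okb => -[] //= x; lia.
have [xs Exs] := parse_push oka pa Hy7 Ey.
move: Ey Ez; rewrite Exs !map_cat !flatten_cat !map_nseq -!map_comp /=.
rewrite (flatten_nseq S 1 7) muln1 flatten_nseq.
move/eqP; rewrite eqseq_cat // eqxx /= => /eqP Ey.
rewrite catA => Ez.
have {}Ey : rev (map yl be) = ychunks xs by rewrite -Ey.
exists xs; split.
  by rewrite [flatten _]/= -size_ychunks -Ey Ez !size_rev !size_map.
move=> i Hi; rewrite [flatten _]/= Ez.
have Hj : M * i < M * size xs by rewrite ltn_pmul2l.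
have := nth_ychunks Hj; rewrite dvdn_mulr // mulKn // -Ey.
have Hsz : M * i < size be by move: Hj; rewrite -size_ychunks -Ey size_rev size_map.
rewrite -!map_rev !(nth_map GTurn) ?size_rev //.
have : nth 0 xs i < 6.
  move: oka; rewrite Exs all_cat => /andP[_]; rewrite all_map => /(all_nthP 0)/(_ _ Hi).
  by [].
(* A first-component letter below 6 excludes [GPopD], which pops the filler 6; [GPopK] pops the same
   letter in both components. *)
by case: (nth GTurn _ _) => [|x||x|x|b] /= ? ?; lia.
Qed.

Hypothesis pre_lt6 : all (fun x => x < 6) pre.
Hypothesis app_lt6 : forall x, all (fun x => x < 6) (app x).

Lemma loop_blocks gs : exists Ls tl,
  [/\ gs = flatten [seq p.1 ++ [:: GLoop p.2] | p <- Ls] ++ tl, ~~ has gloop tl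
    & all (fun p => ~~ has gloop p.1) Ls].
Proof.
elim: gs => [|g gs [Ls [tl [-> Htl HLs]]]]; first by exists [::], [::].
case Hg: (gloop g); first by case: g Hg => // b _; exists (([::], b) :: Ls), tl.
case: Ls HLs => [|[U b] Ls] /= HLs; first by exists [::], (g :: tl); rewrite /= Hg.
by exists ((g :: U, b) :: Ls), tl; rewrite /= Hg.
Qed.

Lemma tfree_pw t s : all (fun x => x < 6) s -> 6 <= t -> tfree t (pw s).
Proof. by move=> Hs Ht; rewrite /tfree all_map; apply: sub_all Hs => x /=; lia. Qed.

Lemma tfree_nseq t j n b : j != t -> tfree t (nseq n (j, b)).
Proof. by move=> jt; rewrite /tfree all_nseq jt orbT. Qed.

Lemma tfree_cat t u v : tfree t (u ++ v) = tfree t u && tfree t v.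
Proof. exact: all_cat. Qed.

Lemma tfree_ww1 U : all gok U -> ~~ has gloop U -> tfree 9 (ww1 U).
Proof.
elim: U => //= g U IH /andP[okg okU]; rewrite negb_or => /andP[lg lU].
rewrite /ww1 /= tfree_cat -/(ww1 U) IH // andbT.
case: g okg lg => //= x ok _; first 1 last.
- by rewrite /tfree /= !andbT; lia.
rewrite /pw map_nseq -/(tfree 9 _).
by rewrite /tfree /= -/(tfree 9 _) tfree_nseq // andbT; lia.
Qed.

Lemma tfree_ww2 U : all gok U -> ~~ has gloop U -> tfree 6 (ww2 U).
Proof.
elim: U => //= g U IH /andP[okg okU]; rewrite negb_or => /andP[lg lU].
rewrite /ww2 /= tfree_cat -/(ww2 U) IH // andbT.
case: g okg lg => //= [_ _|x _ _|x ok _|x ok _].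
- by apply: tfree_pw => //; rewrite all_nseq orbT.
- exact: tfree_pw.
- by rewrite /tfree /= andbT; lia.
- by rewrite /tfree /= andbT; lia.
Qed.

Lemma ww1_blocks L : ww1 (flatten [seq p.1 ++ [:: GLoop p.2] | p <- L]) =
  flatten [seq (ww1 p.1 ++ e1) ++ tp 9 (kloop p.2) | p <- L].
Proof.
have Hl b : ww1 [:: GLoop b] = e1 ++ tp 9 (kloop b) by apply: cats0.
elim: L => [//|p L IH]; by rewrite !map_cons !flatten_cons ww1_cat IH ww1_cat Hl catA.
Qed.

Lemma ww2_blocks L : ww2 (flatten [seq p.1 ++ [:: GLoop p.2] | p <- L]) =
  flatten [seq (ww2 p.1 ++ e2) ++ tp 6 (kloop p.2) | p <- L].
Proof.
have Hl b : ww2 [:: GLoop b] = e2 ++ tp 6 (kloop b) by apply: cats0.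
elim: L => [//|p L IH]; by rewrite !map_cons !flatten_cons ww2_cat IH ww2_cat Hl catA.
Qed.

Lemma identity_tagsol gs : all gok gs -> gs <> [::] ->
  wmat (ww1 gs) = 1%R -> wmat (ww2 gs) = 1%R ->
  exists xs, tagsol (pre ++ nseq (S * X) 0) xs.
Proof.
have [Ls [tl [-> Htl HLs]]] := loop_blocks gs.
case: Ls HLs => [|[U b] Ls] /=.
  by move=> _ ok ne H1 _; case: ne; apply: noloop_trivial.
move=> /andP[lU HLs].
set A := (U ++ _) ++ flatten _ => ok _ E1 E2.
(* The tail without loops is rotated to the front, so that every block ends with a loop. *)
pose Ls' := (tl ++ U, b) :: Ls.
pose gs' := flatten [seq p.1 ++ [:: GLoop p.2] | p <- Ls'].
have {E1} E1 : wmat (ww1 gs') = 1%R.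
  rewrite [gs'](_ : _ = tl ++ A); last by rewrite /gs' /A /= -!catA.
  by move: E1; rewrite !ww1_cat !wmat_cat; apply: mulmx1C.
have {E2} E2 : wmat (ww2 gs') = 1%R.
  rewrite [gs'](_ : _ = tl ++ A); last by rewrite /gs' /A /= -!catA.
  by move: E2; rewrite !ww2_cat !wmat_cat; apply: mulmx1C.
have HLs' : all (fun p => all gok p.1 && ~~ has gloop p.1) Ls'.
  move: ok; rewrite /A !all_cat /= => /andP[/andP[/andP[okU _] okLs] oktl].
  rewrite /= all_cat okU oktl has_cat negb_or lU Htl /=.
  elim: (Ls) HLs okLs => //= p L IH /andP[lp lL]; rewrite !all_cat => /andP[/andP[-> _] okL].
  by rewrite lp IH.
pose f1 (p : seq gen * bool) := (ww1 p.1 ++ e1, kloop p.2).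
pose f2 (p : seq gen * bool) := (ww2 p.1 ++ e2, kloop p.2).
have C1 : 5 * count (fun p => wmat (f1 p).1 != 1%R) Ls' <= 2 * size Ls'.
  have := @count_nontrivial 9 (map f1 Ls'); rewrite count_map size_map; apply.
  - rewrite all_map; apply: sub_all HLs' => p /andP[okp lp].
    by rewrite /= tfree_cat tfree_ww1 //= /e1 /tfree /= -/(tfree 9 _) tfree_nseq.
  - by rewrite all_map; apply/(all_nthP ([::], false)) => i _ /=; case: (nth _ _ _).2.
  - by rewrite -E1 /gs' ww1_blocks -map_comp.
have C2 : 5 * count (fun p => wmat (f2 p).1 != 1%R) Ls' <= 2 * size Ls'.
  have := @count_nontrivial 6 (map f2 Ls'); rewrite count_map size_map; apply.
  - rewrite all_map; apply: sub_all HLs' => p /andP[okp lp].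
    by rewrite /= tfree_cat tfree_ww2 //= /e2 tfree_pw.
  - by rewrite all_map; apply/(all_nthP ([::], false)) => i _ /=; case: (nth _ _ _).2.
  - by rewrite -E2 /gs' ww2_blocks -map_comp.
have : ~~ all (fun p => (wmat (f1 p).1 != 1%R) || (wmat (f2 p).1 != 1%R)) Ls'.
  rewrite all_count; apply/negP => /eqP E.
  have := count_predUI (fun p => wmat (f1 p).1 != 1%R) (fun p => wmat (f2 p).1 != 1%R) Ls'.
  rewrite E; move: C1 C2; have : 0 < size Ls' by [].
  lia.
move=> /has_split [L1 [p [L2 [EL]]]]; rewrite negb_or !negbK => /andP[/eqP T1 /eqP T2].
move: HLs'; rewrite EL all_cat /= => /and3P[_ /andP[okp lp] _].
exact: trivial_block okp lp T1 T2.
Qed.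

Lemma block_cancel (A Y W C l l' : 'M[int]_2) : (l * l' = 1)%R -> (Y * W = 1)%R ->
  (A * C = 1)%R -> (A * Y * (l * (l' * W * l)) * (l' * C) = 1)%R.
Proof.
move=> ll' YW AC.
by rewrite -!mulrA (mulrA l l') ll' mul1r (mulrA l l') ll' mul1r (mulrA Y W) YW mul1r.
Qed.

Lemma tagsol_identity xs : tagsol (pre ++ nseq (S * X) 0) xs ->
  exists gs, [/\ all gok gs, gs <> [::], wmat (ww1 gs) = 1%R & wmat (ww2 gs) = 1%R].
Proof.
rewrite /tagsol; set Z := _ ++ _ => -[sZ HZ].
have Z6 : all (fun x => x < 6) Z.
  rewrite /Z !all_cat pre_lt6 all_nseq orbT /=.
  by elim: (xs) => //= x s IH; rewrite all_cat app_lt6.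
have nZ j : nth 0 Z j < 6.
  case: (ltnP j (size Z)) => Hj; last by rewrite nth_default.
  by move/(all_nthP 0): Z6; apply.
have xs6 : all (fun x => x < 6) xs by apply/(all_nthP 0) => i Hi; rewrite -HZ.
pose pp j := if M %| j then GPopK (nth 0 Z j) else GPopD (nth 0 Z j).
pose be := rev (map pp (iota 0 (M * size xs))).
pose al := nseq S GI ++ map GPush xs.
pose U := al ++ GTurn :: be.
have okb : all gok be.
  by rewrite all_rev all_map; apply/allP => j _; rewrite /= /pp; case: ifP => _; apply: nZ.
have pb : all gpop be.
  by rewrite all_rev all_map; apply/allP => j _; rewrite /= /pp; case: ifP.
have oka : all gok al by rewrite all_cat all_nseq orbT all_map.
have pa : all gpush al by rewrite all_cat all_nseq orbT all_map; apply/allP.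
have Ey : rev (map yl be) = ychunks xs.
  rewrite map_rev revK -map_comp; apply: (@eq_from_nth _ 0).
    by rewrite size_map size_iota size_ychunks.
  move=> j; rewrite size_map size_iota => Hj.
  rewrite (nth_map 0) ?size_iota // nth_iota // add0n nth_ychunks //= /pp.
  case: ifP => //= /dvdnP[q Eq]; rewrite Eq mulnK // mulnC HZ //.
  by move: Hj; rewrite Eq mulnC ltn_pmul2l.
have Ez : rev (map zl be) = Z.
  rewrite map_rev revK -map_comp; apply: (@eq_from_nth _ 0).
    by rewrite size_map size_iota.
  move=> j; rewrite size_map size_iota => Hj.
  by rewrite (nth_map 0) ?size_iota // nth_iota // add0n /= /pp; case: ifP.
have H1 : wmat (ww1 U ++ e1) = 1%R.
  rewrite /U ww1_cat /ww1 [flatten (map w1 (_ :: _))]/= -!/(ww1 _) /e1.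
  rewrite wmat_cat wmat_cat !wmat_cons (wmat_pop pb) (ww1_push pa) Ey.
  have -> : flatten (map a1 al) = nseq S 7 ++ ychunks xs.
    by rewrite /al map_cat flatten_cat map_nseq (flatten_nseq S 1 7) muln1 -map_comp.
  have -> : nseq S (7, false) = winv (pw (nseq S 7)) by rewrite winv_pw rev_nseq map_nseq.
  rewrite pw_cat wmat_cat; apply: block_cancel; rewrite ?wmatKr //.
  exact: (lmatK' 8 false).
have H2 : wmat (ww2 U ++ e2) = 1%R.
  rewrite /U ww2_cat /ww2 [flatten (map w2 (_ :: _))]/= -!/(ww2 _) /e2.
  rewrite 2!wmat_cat (ww2_pop pb) (ww2_push pa) Ez.
  have EZ : pre ++ flatten (map a2 al) = Z.
    by rewrite /Z /al map_cat flatten_cat map_nseq flatten_nseq catA -map_comp.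
  have ZK := wmatKr (pw Z); rewrite -{1}EZ pw_cat wmat_cat -mulrA in ZK.
  by apply: mulmx1C.
have okU : all gok U by rewrite all_cat oka /= okb.
have L1 b : wmat (ww1 (U ++ [:: GLoop b])) = wmat (tp 9 (kloop b)).
  have Hl : ww1 [:: GLoop b] = e1 ++ tp 9 (kloop b) by apply: cats0.
  by rewrite ww1_cat Hl catA wmat_cat H1 mul1r.
have L2 b : wmat (ww2 (U ++ [:: GLoop b])) = wmat (tp 6 (kloop b)).
  have Hl : ww2 [:: GLoop b] = e2 ++ tp 6 (kloop b) by apply: cats0.
  by rewrite ww2_cat Hl catA wmat_cat H2 mul1r.
have [V okV HV] : exists2 V : bool -> seq gen, forall b, all gok (V b) &
    forall b, V b <> [::] /\ wmat (ww1 (V b)) = wmat (tp 9 (kloop b)) /\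
              wmat (ww2 (V b)) = wmat (tp 6 (kloop b)).
  by exists (fun b => U ++ [:: GLoop b]) => b; [rewrite all_cat okU | split=> //; case: (U)].
(* Four factors [t^(-1)] and one [t^4] cancel in both components. *)
exists (V false ++ V false ++ V false ++ V false ++ V true); split.
- by rewrite !all_cat !okV.
- by have [] := HV false; case: (V false).
- by rewrite !ww1_cat !wmat_cat !(HV _).2.1 !wmat_tpD wmat_nil.
- by rewrite !ww2_cat !wmat_cat !(HV _).2.2 !wmat_tpD wmat_nil.
Qed.

End Encoding.

(** * Tag systems simulate generalised Collatz functions *)

Lemma drop_cat_le (T : Type) n (u v : seq T) : n <= size u -> drop n (u ++ v) = drop n u ++ v.
Proof.
rewrite drop_cat; case: ltngtP => // -> _.
by rewrite subnn drop0 drop_oversize.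
Qed.

Section TagSystem.
Variables (M : nat) (app : nat -> seq nat).
Hypothesis M_gt0 : 0 < M.

Fixpoint tsteps k (w w' : seq nat) : Prop :=
  if k is k'.+1 then M <= size w /\ tsteps k' (drop M w ++ app (head 0 w)) w' else w = w'.

Lemma tsteps_trans k m u v w : tsteps k u v -> tsteps m v w -> tsteps (k + m) u w.
Proof. by elim: k u => [|k IH] u /= => [->//|[Hu H] H']; split=> //; apply: IH. Qed.

Lemma tsteps_prefix k m u w : tsteps (k + m) u w -> exists v, tsteps k u v.
Proof.
elim: k u => [|k IH] u /=; first by exists u.
by move=> [Hu /IH[v Hv]]; exists v.
Qed.

Lemma tagsol_step w x xs : M <= size w -> head 0 w = x ->
  tagsol M app w (x :: xs) <-> tagsol M app (drop M w ++ app x) xs.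
Proof.
move=> Hw Hx; rewrite /tagsol /=.
have E : (drop M w ++ app x) ++ flatten (map app xs) =
         drop M (w ++ app x ++ flatten (map app xs)).
  by rewrite drop_cat_le // -catA.
set Z := w ++ _ in E *; rewrite E.
have sZ : M <= size Z by rewrite size_cat; apply: leq_trans Hw (leq_addr _ _).
have Z0 : nth 0 Z 0 = x.
  by rewrite /Z nth_cat (leq_trans M_gt0 Hw) nth0.
split=> -[Hs Hn]; split.
- by rewrite size_drop Hs mulnS addKn.
- by move=> i Hi; rewrite nth_drop -mulnS; apply: (Hn i.+1).
- by rewrite mulnS -Hs size_drop subnKC.
- by case=> [|i] Hi; rewrite ?muln0 // mulnS -nth_drop; apply: Hn.
Qed.

Lemma tagsol_halt k w : tsteps k w [::] -> exists xs, tagsol M app w xs.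
Proof.
elim: k w => [|k IH] w /=; first by move=> ->; exists [::]; rewrite /tagsol /= muln0.
by move=> [Hw /IH[xs H]]; exists (head 0 w :: xs); apply/tagsol_step.
Qed.

(** The system is deterministic, and a solution forces its run to reach the empty word after
    [size xs] steps, where no step is possible. *)
Lemma tagsol_size k w w' xs : tagsol M app w xs -> tsteps k w w' -> k <= size xs.
Proof.
elim: k w xs => [//|k IH] w xs H /= [Hw Hs].
case: xs H => [|x xs] H.
  by case: H => /=; rewrite cats0 muln0 => /size0nil Ew; move: Hw; rewrite Ew leqNgt M_gt0.
have Ex : head 0 w = x.
  case: H => /= _ /(_ 0 isT); rewrite muln0 /= nth_cat (leq_trans M_gt0 Hw) nth0.
  by [].
by move/(tagsol_step _ Hw Ex): H => H; rewrite Ex in Hs; apply: IH H Hs.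
Qed.

(** Each step deletes one column length, so the offset [ph] persists and only the entries of index
    [ph] are read. The bound [ph <= size z] leaves [M] letters for every deletion. *)
Lemma cols_steps ph cols z : all (fun c => size c == M) cols -> ph < M -> ph <= size z ->
  tsteps (size cols) (drop ph (flatten cols ++ z))
         (drop ph (z ++ flatten [seq app (nth 0 c ph) | c <- cols])).
Proof.
move=> + Hph; elim: cols z => [|c cs IH] z /=; first by rewrite cats0.
move=> /andP[/eqP sc Hcs] Hz; split.
  by rewrite size_drop !size_cat sc; lia.
rewrite -catA drop_cat sc Hph drop_cat size_drop sc.
have -> : (M < M - ph) = false by lia.
have -> : M - (M - ph) = ph by lia.
have -> : head 0 (drop ph c ++ flatten cs ++ z) = nth 0 c ph.
  by rewrite -nth0 nth_cat size_drop sc subn_gt0 Hph nth_drop addn0.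
rewrite -drop_cat_le; last by rewrite size_cat; lia.
rewrite -catA [z ++ _ ++ flatten _]catA; apply: IH => //.
by rewrite size_cat; lia.
Qed.

Lemma col_step ph x z : ph < M -> ph <= size z ->
  tsteps 1 (drop ph (nseq M x ++ z)) (drop ph (z ++ app x)).
Proof.
move=> Hph Hz; have := @cols_steps ph [:: nseq M x] z.
rewrite [flatten [:: _]]/= [flatten (map _ _)]/= !cats0 nth_nseq Hph.
by apply=> //; rewrite /= size_nseq eqxx.
Qed.

End TagSystem.

(** * The tag system of a generalised Collatz function *)

Section Collatz.
(* A generalised Collatz function: [t * M + r] is sent to [a r * t + b r], and the residues
   [r] with [hl r] halt. *)
Variables (M K : nat) (a b : nat -> nat) (hl : nat -> bool).
Hypothesis M_gt0 : 0 < M.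
Hypothesis a_le : forall r, r < M -> a r <= K.
Hypothesis b_le : forall r, r < M -> M + b r < K.

Definition pad (w : seq nat) := w ++ nseq (K - size w) 5.

Definition row_c r := if hl r then [::] else nseq (a r) 3.
(** A halting residue yields exactly [M - 1 - r] blanks, which the offset [M - 1 - r] removes, so
    the run ends in the empty word. *)
Definition row_h r :=
  if hl r then nseq (M.-1 - r) 4 else 2 :: nseq (M - r) 4 ++ nseq (b r) 3.

(* Position [k * M + ph] of an array holds entry [k] of the row of the residue [M - 1 - ph]:
   reading every [M]-th letter of the array from the offset [ph] selects that row. *)
Definition cols (row : nat -> seq nat) :=
  [seq [seq nth 5 (pad (row (M.-1 - ph))) k | ph <- iota 0 M] | k <- iota 0 K].

(* 0 is the unit, 1 the header read once per pass, 2, 3 and 4 are the table entries producing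
   a header, a unit and a blank, and 5 is the blank. *)
Definition capp (x : nat) : seq nat :=
  match x with
  | 0 => flatten (cols row_c)
  | 1 => flatten (cols row_h) ++ nseq M 5
  | 2 => nseq M 1
  | 3 => [:: 0]
  | 4 => [:: 5]
  | _ => [::]
  end.

Definition cpre := nseq M 1 ++ [:: 5].

(** The offset [ph] is left over from the previous pass. Once the header is read, just one of the
    [ph + 1] blanks remains; reading it resets the offset to [M - 1], whatever [ph] was. *)
Definition conf ph n := drop ph (nseq M 1 ++ nseq ph.+1 5 ++ nseq n 0).

Lemma cols_size row : all (fun c => size c == M) (cols row).
Proof. by rewrite all_map; apply/allP => k _; rewrite /= size_map size_iota. Qed.

Lemma capp_pad w : flatten (map capp (pad w)) = flatten (map capp w).
Proof.
rewrite /pad map_cat flatten_cat map_nseq [X in _ ++ X](_ : _ = [::]) ?cats0 //.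
by elim: (_ - _).
Qed.

Lemma cols_out row r : r < M -> size (row r) <= K ->
  flatten [seq capp (nth 0 c (M.-1 - r)) | c <- cols row] = flatten (map capp (row r)).
Proof.
move=> Hr Hs; rewrite -capp_pad /cols -map_comp; congr flatten.
have <- : mkseq (nth 5 (pad (row r))) K = pad (row r).
  have sp : size (pad (row r)) = K by rewrite size_cat size_nseq; lia.
  rewrite -[in LHS]sp.
  exact: mkseq_nth.
rewrite /mkseq -map_comp; apply: eq_map => k /=.
rewrite (nth_map 0) ?size_iota ?nth_iota; try lia.
by congr (capp (nth 5 (pad (row _)) k)); lia.
Qed.

Lemma capp_nseq n x : flatten (map capp (nseq n x)) = flatten (nseq n (capp x)).
Proof. by rewrite map_nseq. Qed.

Lemma flatten_nseq1 (T : Type) n (x : T) : flatten (nseq n [:: x]) = nseq n x.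
Proof. by rewrite (flatten_nseq n 1) muln1. Qed.

Lemma row_c_out r : flatten (map capp (row_c r)) = nseq (if hl r then 0 else a r) 0.
Proof. by rewrite /row_c; case: (hl r) => //; rewrite capp_nseq flatten_nseq1. Qed.

Lemma row_h_out r : flatten (map capp (row_h r)) =
  if hl r then nseq (M.-1 - r) 5 else nseq M 1 ++ nseq (M - r) 5 ++ nseq (b r) 0.
Proof.
rewrite /row_h; case: (hl r); first by rewrite capp_nseq flatten_nseq1.
by rewrite /= map_cat flatten_cat !capp_nseq !flatten_nseq1.
Qed.

Lemma flatten_flatten (T : Type) n (ss : seq (seq T)) :
  flatten (flatten (nseq n ss)) = flatten (nseq n (flatten ss)).
Proof. by elim: n => //= n IH; rewrite flatten_cat IH. Qed.

Lemma conf_steps ph n : ph < M -> let r := n %% M in exists2 k, 0 < k &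
  tsteps M capp k (conf ph n)
    (if hl r then [::] else conf (M.-1 - r) (b r + a r * (n %/ M))).
Proof.
move=> Hph r; set t := n %/ M.
have rM : r < M by apply: ltn_pmod.
have bK := b_le rM; have aK := a_le rM.
set H := capp 1; set A := capp 0.
have sH : M <= size H by rewrite /H /= size_cat size_nseq leq_addl.
have S1 : tsteps M capp 1 (conf ph n) (drop ph (nseq ph.+1 5 ++ nseq n 0 ++ H)).
  have := @col_step M capp M_gt0 ph 1 (nseq ph.+1 5 ++ nseq n 0) Hph.
  by rewrite -[(_ ++ _) ++ capp 1]catA; apply; rewrite size_cat !size_nseq; lia.
have E1 : drop ph (nseq ph.+1 5 ++ nseq n 0 ++ H) = drop M.-1 (nseq M 5 ++ nseq n 0 ++ H).
  rewrite !drop_cat !size_nseq ltnSn prednK // leqnn !drop_nseq.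
  by congr (nseq _ _ ++ _); lia.
have S2 : tsteps M capp 1 (drop M.-1 (nseq M 5 ++ nseq n 0 ++ H)) (drop M.-1 (nseq n 0 ++ H)).
  have := @col_step M capp M_gt0 M.-1 5 (nseq n 0 ++ H).
  rewrite [_ ++ capp 5]cats0; apply; first by rewrite prednK.
  by rewrite size_cat; apply: leq_trans (leq_pred M) (leq_trans sH (leq_addl _ _)).
(* The [r] units left after [t] full columns turn the offset [M - 1] into [M - 1 - r], which records
   the residue. *)
have S3 : tsteps M capp t (drop M.-1 (nseq n 0 ++ H))
                         (drop (M.-1 - r) (H ++ flatten (nseq t A))).
  have := @cols_steps M capp M_gt0 M.-1 (nseq t (nseq M 0)) (nseq r 0 ++ H).
  rewrite size_nseq flatten_nseq catA -nseqD -divn_eq map_nseq nth_nseq prednK // leqnn.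
  have -> : drop M.-1 ((nseq r 0 ++ H) ++ flatten (nseq t (capp 0))) =
            drop (M.-1 - r) (H ++ flatten (nseq t A)).
    by rewrite -catA drop_cat size_nseq ifN // -leqNgt; lia.
  apply=> //; first by rewrite all_nseq size_nseq eqxx orbT.
  by rewrite size_cat; lia.
set out := flatten (map capp (row_h r)).
(* The [M] blanks ending [H] guarantee enough letters behind the table while it is read. *)
have S4 : tsteps M capp (size (cols row_h)) (drop (M.-1 - r) (H ++ flatten (nseq t A)))
   (drop (M.-1 - r) (nseq M 5 ++ flatten (nseq t A) ++ out)).
  have := @cols_steps M capp M_gt0 (M.-1 - r) (cols row_h) (nseq M 5 ++ flatten (nseq t A)).
  rewrite cols_out // -?catA; last first.
    by rewrite /row_h; case: (hl r); rewrite /= ?size_cat ?size_nseq; lia.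
  apply; [exact: cols_size | lia |].
  by rewrite size_cat size_nseq; lia.
have S5 : exists m, tsteps M capp m (drop (M.-1 - r) (nseq M 5 ++ flatten (nseq t A) ++ out))
   (drop (M.-1 - r) (out ++ nseq (t * (if hl r then 0 else a r)) 0)).
  pose cs := nseq M 5 :: flatten (nseq t (cols row_c)).
  exists (size cs); have := @cols_steps M capp M_gt0 (M.-1 - r) cs out.
  rewrite [flatten cs]/= flatten_flatten -catA.
  have -> : flatten [seq capp (nth 0 c (M.-1 - r)) | c <- cs] =
            nseq (t * (if hl r then 0 else a r)) 0.
    rewrite /cs /= nth_nseq ifT /=; last by lia.
    rewrite -flatten_nseq -row_c_out -(cols_out rM); last first.
      by rewrite /row_c; case: (hl r); rewrite ?size_nseq.
    by elim: (t) => //= t' IH; rewrite map_cat flatten_cat IH.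
  apply.
  - rewrite /= size_nseq eqxx /=; elim: (t) => //= t' IH.
    by rewrite all_cat cols_size IH.
  - lia.
  - by rewrite /out row_h_out; case: (hl r); rewrite ?size_cat size_nseq; lia.
case: S5 => m S5.
exists (1 + 1 + t + size (cols row_h) + m); first by [].
have -> : (if hl r then [::] else conf (M.-1 - r) (b r + a r * t)) =
   drop (M.-1 - r) (out ++ nseq (t * (if hl r then 0 else a r)) 0).
  rewrite /out row_h_out /conf; case: (hl r).
    by rewrite muln0 cats0 drop_oversize // size_nseq.
  have -> : (M.-1 - r).+1 = M - r by lia.
  by rewrite -!catA -nseqD mulnC.
rewrite -E1 in S2.
exact: tsteps_trans (tsteps_trans (tsteps_trans (tsteps_trans S1 S2) S3) S4) S5.
Qed.

End Collatz.

(** * Minsky machines as generalised Collatz functions *)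

(* Sylvester's sequence 2, 3, 7, 43, ... supplies pairwise coprime bases. *)
Fixpoint sylvprod n := if n is n'.+1 then sylvprod n' * (sylvprod n').+1 else 1.
Definition sylv n := (sylvprod n).+1.

Lemma sylv_dvd i n : i < n -> sylv i %| sylvprod n.
Proof.
elim: n => // n IH; rewrite ltnS leq_eqVlt => /orP[/eqP->|/IH H] /=.
  by rewrite dvdn_mull.
by rewrite dvdn_mulr.
Qed.

Lemma sylv_coprime i j : i != j -> coprime (sylv i) (sylv j).
Proof.
wlog lt_ij : i j / i < j => [H ne|_].
  by case: (ltngtP i j) ne => // lt _; [|rewrite coprime_sym]; apply: H; rewrite ?neq_ltn lt.
by apply: coprime_dvdl (sylv_dvd lt_ij) _; apply: coprimenS.
Qed.

Lemma sylv_gt1 i : 1 < sylv i.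
Proof. by rewrite /sylv ltnS; elim: i => //= n H; rewrite muln_gt0 H. Qed.

Definition instr_reg (i : instr) := match i with INC r | DEC r _ => r end.

Section MinskyCollatz.
Variable P : program.

Definition nregs := (\max_(i <- P) instr_reg i).+1.
Definition mS := (size P).+1.
Definition mB := \prod_(i < nregs) sylv i.
(** A residue modulo [mM] determines the program counter and the Goedel number modulo [mB], hence
    which registers are zero. *)
Definition mM := mS * mB.
Definition instr_at pc := nth (INC 0) P pc.

Definition mhl r := r %% mS == size P.
Definition ma r :=
  match instr_at (r %% mS) with
  | INC i => mM * sylv i
  | DEC i j => if sylv i %| r %/ mS then mM %/ sylv i else mM
  end.
Definition mb r :=
  match instr_at (r %% mS) with
  | INC i => r %/ mS * sylv i * mS + (r %% mS).+1
  | DEC i j => if sylv i %| r %/ mS then r %/ mS %/ sylv i * mS + (r %% mS).+1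
               else r %/ mS * mS + minn j (size P)
  end.

Definition godel (regs : seq nat) := \prod_(i < nregs) sylv i ^ reg regs i.
(** Counters beyond the program are all identified with [size P], so that they fit below [mS]. *)
Definition mcode (c : config) := godel c.2 * mS + minn c.1 (size P).

Lemma mB_gt0 : 0 < mB.
Proof. by rewrite prodn_gt0 // => i; rewrite ltnW ?sylv_gt1. Qed.

Lemma sylv_dvdB i : i < nregs -> sylv i %| mB.
Proof. by move=> Hi; rewrite /mB (bigD1 (Ordinal Hi)) //= dvdn_mulr. Qed.

Lemma instr_reg_lt pc : pc < size P -> instr_reg (instr_at pc) < nregs.
Proof.
rewrite /nregs /instr_at ltnS; elim: P pc => // i Q IH [|pc] /=; rewrite big_cons leq_max ?leqnn //.
by rewrite ltnS => /IH ->; rewrite orbT.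
Qed.

Lemma reg_setreg regs i v j : reg (setreg regs i v) j = if j == i then v else reg regs j.
Proof. by rewrite /reg /setreg nth_set_nth. Qed.

Definition godel_rest regs i := \prod_(j < nregs | j != i :> nat) sylv j ^ reg regs j.

Lemma godel_split regs i : i < nregs -> godel regs = sylv i ^ reg regs i * godel_rest regs i.
Proof. by move=> Hi; rewrite /godel (bigD1 (Ordinal Hi)). Qed.

Lemma godel_set regs i v : i < nregs ->
  godel (setreg regs i v) = sylv i ^ v * godel_rest regs i.
Proof.
move=> Hi; rewrite (godel_split _ Hi) reg_setreg eqxx; congr (_ * _).
by apply: eq_bigr => j ne; rewrite reg_setreg (negbTE ne).
Qed.

Lemma godel_dvd regs i : i < nregs -> (sylv i %| godel regs) = (0 < reg regs i).
Proof.
move=> Hi; rewrite (godel_split _ Hi); case: (reg regs i) => [|k].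
  rewrite mul1n; apply/negP => H.
  have : coprime (sylv i) (godel_rest regs i).
    rewrite /godel_rest; apply: (big_ind (coprime (sylv i))); first exact: coprimen1.
      by move=> x y Hx Hy; rewrite coprimeMr Hx.
    by move=> j ne; apply: coprimeXr; apply: sylv_coprime; rewrite eq_sym.
  by rewrite /coprime; move/gcdn_idPl: H => -> /eqP E; have := sylv_gt1 i; rewrite E.
by rewrite expnS -mulnA dvdn_mulr.
Qed.

Section Step.
Variables (pc : nat) (regs : seq nat).
Let n := mcode (pc, regs).
Let r := n %% mM.

Lemma code_pc : r %% mS = minn pc (size P).
Proof.
rewrite /r modn_dvdm ?dvdn_mulr // /n /mcode /= modnMDl modn_small //.
by rewrite ltnS geq_minr.
Qed.

Lemma code_div : n %/ mS = godel regs.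
Proof. by rewrite /n /mcode /= divnMDl // divn_small ?addn0 // ltnS geq_minr. Qed.

Lemma code_quo : n %/ mM = godel regs %/ mB.
Proof. by rewrite /mM divnMA code_div. Qed.

Lemma code_rem : r %/ mS = godel regs %% mB.
Proof. by rewrite /r /mM mulnC -modn_divl code_div. Qed.

Lemma code_halt : step P (pc, regs) = None <-> mhl r.
Proof.
rewrite /mhl code_pc /step; case: ltnP => Hpc; last by split=> // _; apply/eqP/minn_idPr.
split; last by move=> /eqP; lia.
by case: (nth _ _ _) => // i j; case: (reg regs i).
Qed.

(** Write the Goedel number as [t mB + e]. Multiplying by a base, or dividing by it when that is
    exact, acts on both summands, since each base divides [mB]. *)
Lemma code_step pc' regs' : step P (pc, regs) = Some (pc', regs') ->
  mcode (pc', regs') = mb r + ma r * (n %/ mM).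
Proof.
rewrite /step; case: ltnP => // Hpc; rewrite -/(instr_at pc).
have Epc : r %% mS = pc by rewrite code_pc; apply/minn_idPl/ltnW.
have Ei := instr_reg_lt Hpc.
have Hm : minn pc.+1 (size P) = pc.+1 by apply/minn_idPl.
have HE := divn_eq (godel regs) mB.
rewrite /mb /ma Epc code_quo code_rem /mcode.
move: (godel regs %/ mB) (godel regs %% mB) HE => t e HE.
case Ein: (instr_at pc) Ei => [i|i j] /= Hi.
  move=> [<- <-]; rewrite Hm godel_set // expnS -(mulnA (sylv i)) -godel_split // HE /mM; ring.
have Hd : (sylv i %| e) = (0 < reg regs i).
  by rewrite -godel_dvd // HE dvdn_addr // dvdn_mull // sylv_dvdB.
rewrite Hd; case Er: (reg regs i) => [|k] /= [<- <-]; first by rewrite HE /mM; ring.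
rewrite Hm godel_set //.
have Eg : godel regs = sylv i * (sylv i ^ k * godel_rest regs i).
  by rewrite (godel_split _ Hi) Er expnS mulnA.
have {}Hd : sylv i %| e by rewrite Hd Er.
have HB := sylv_dvdB Hi.
have s0 : 0 < sylv i by rewrite ltnW ?sylv_gt1.
have -> : sylv i ^ k * godel_rest regs i = t * (mB %/ sylv i) + e %/ sylv i.
  apply/eqP; rewrite -(eqn_pmul2l s0) -Eg HE mulnDr mulnCA !(mulnC (sylv i)) !divnK //.
rewrite /mM -muln_divA //; ring.
Qed.

End Step.

Definition mK := \sum_(r < mM) (ma r + (mM + mb r).+1).

Lemma mM_gt0 : 0 < mM. Proof. by rewrite muln_gt0 mB_gt0. Qed.

Lemma ma_le r : r < mM -> ma r <= mK.
Proof. by move=> Hr; rewrite /mK (bigD1 (Ordinal Hr)) //= -addnA leq_addr. Qed.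

Lemma mb_le r : r < mM -> mM + mb r < mK.
Proof. by move=> Hr; rewrite /mK (bigD1 (Ordinal Hr)) //=; lia. Qed.

Definition mapp := capp mM mK ma mb mhl.
Definition mpre := cpre mM.

Lemma minsky_conf ph c : ph < mM -> exists2 k, 0 < k &
  if step P c is Some c' then exists2 ph', ph' < mM &
    tsteps mM mapp k (conf mM ph (mcode c)) (conf mM ph' (mcode c'))
  else tsteps mM mapp k (conf mM ph (mcode c)) [::].
Proof.
case: c => pc regs Hph.
have [k k0 H] := conf_steps mhl mM_gt0 ma_le mb_le (mcode (pc, regs)) Hph.
exists k => //; have := code_halt pc regs; have := @code_step pc regs.
case: (step P (pc, regs)) => [[pc' regs']|] Hs Hh.
  have Hr : mhl (mcode (pc, regs) %% mM) = false by apply/negP => /Hh.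
  exists (mM.-1 - mcode (pc, regs) %% mM); first by have := mM_gt0; lia.
  by move: H; rewrite Hr -(Hs _ _ erefl).
by move: H; rewrite (Hh.1 erefl).
Qed.

Lemma minsky_halt m ph c : ph < mM -> step P (run P m c) = None ->
  exists k, tsteps mM mapp k (conf mM ph (mcode c)) [::].
Proof.
elim: m ph c => [|m IH] ph c Hph /=.
  by have [k _ H] := minsky_conf c Hph => E; rewrite E in H; exists k.
have [k _] := minsky_conf c Hph; case E: (step P c) => [c'|] H.
  case: H => ph' Hph' H /(IH _ _ Hph')[k' H'].
  by exists (k + k'); apply: tsteps_trans H H'.
by move=> _; exists k.
Qed.

(** Each machine step costs at least one tag step, so [k] machine steps without halting give at
    least [k] tag steps. *)
Lemma minsky_run k ph c : ph < mM -> (exists m, step P (run P m c) = None) \/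
  exists w, tsteps mM mapp k (conf mM ph (mcode c)) w.
Proof.
move=> Hph.
suff [H|[k' [w [Hk H]]]] : (exists m, step P (run P m c) = None) \/
    exists k' w, k <= k' /\ tsteps mM mapp k' (conf mM ph (mcode c)) w.
- by left.
- by right; rewrite -(subnKC Hk) in H; apply: tsteps_prefix H.
elim: k ph c Hph => [|k IH] ph c Hph; first by right; exists 0, (conf mM ph (mcode c)).
have [k1 k10] := minsky_conf c Hph.
case E: (step P c) => [c'|]; last by left; exists 0.
move=> [ph' Hph' H]; case: (IH _ c' Hph') => [[m Hm]|[k2 [w [Hk H']]]].
  by left; exists m.+1; rewrite /= E.
by right; exists (k1 + k2), w; split; [lia | apply: tsteps_trans H H'].
Qed.

(** Register 0 has base [sylv 0 = 2], so the input contributes [2 ^ x]; the factor [mS] comes from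
    the packing of the program counter, initially 0. *)
Lemma mcode_init x : mpre ++ nseq (mS * 2 ^ x) 0 = conf mM 0 (mcode (0, [:: x])).
Proof.
rewrite /conf drop0 /mpre /cpre -catA; congr (_ ++ 5 :: nseq _ 0).
rewrite /mcode min0n addn0 mulnC; congr (_ * _).
rewrite (godel_split _ (isT : 0 < nregs)) /= /godel_rest big1 ?muln1 //.
by move=> [[|j] Hj] //= _; rewrite /reg /= nth_nil.
Qed.

Lemma halts_tagsol x : (exists m, step P (run P m (0, [:: x])) = None) <->
  exists xs, tagsol mM mapp (mpre ++ nseq (mS * 2 ^ x) 0) xs.
Proof.
rewrite mcode_init; split=> [[m /(minsky_halt mM_gt0)[k]]|[xs Hxs]].
  exact: (tagsol_halt mM_gt0).
case: (minsky_run (size xs).+1 (0, [:: x]) mM_gt0) => // -[w Hw].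
by have := tagsol_size mM_gt0 Hxs Hw; rewrite ltnn.
Qed.

End MinskyCollatz.

(** * Compiling loop programs to Minsky machines *)

Definition reach (Q : program) (c c' : config) := exists n, run Q n c = c'.

Lemma run_add Q n m c : run Q (n + m) c = run Q m (run Q n c).
Proof.
elim: n c => //= n IH c; case E: (step Q c) => [c'|]; first exact: IH.
by case: m {IH} => //= m; rewrite E.
Qed.

Lemma run_halted Q n c : step Q c = None -> run Q n c = c.
Proof. by case: n => //= n ->. Qed.

Lemma runS Q n c c' : step Q c = Some c' -> run Q n.+1 c = run Q n c'.
Proof. by move=> /= ->. Qed.

Lemma step_at Q pc regs i : pc < size Q -> nth (INC 0) Q pc = i ->
  step Q (pc, regs) =
  match i with
  | INC r => Some (pc.+1, setreg regs r (reg regs r).+1)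
  | DEC r j => if reg regs r is k.+1 then Some (pc.+1, setreg regs r k) else Some (j, regs)
  end.
Proof. by move=> H <-; rewrite /step H. Qed.

Lemma reach_refl Q c : reach Q c c.
Proof. by exists 0. Qed.

Lemma reach_trans Q c1 c2 c3 : reach Q c1 c2 -> reach Q c2 c3 -> reach Q c1 c3.
Proof. by move=> [n <-] [m <-]; exists (n + m); rewrite run_add. Qed.

Lemma reach_step Q c c' : step Q c = Some c' -> reach Q c c'.
Proof. by move=> E; exists 1; rewrite /= E. Qed.

Definition halts (Q : program) (c : config) := exists n, step Q (run Q n c) = None.

Lemma halts_reach Q c c' : reach Q c c' -> halts Q c <-> halts Q c'.
Proof.
move=> [k <-]; split=> -[n Hn]; last by exists (k + n); rewrite run_add.
exists n; rewrite -run_add addnC run_add run_halted //.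
Qed.

Definition state := nat -> nat.
Definition upd (s : state) r v : state := fun i => if i == r then v else s i.
Definition rep (regs : seq nat) (s : state) := reg regs =1 s.

Lemma rep_set regs s r v : rep regs s -> rep (setreg regs r v) (upd s r v).
Proof. by move=> H i; rewrite reg_setreg /upd H. Qed.

(** [CLoop r c] decrements [r] before each pass; as [wf] forbids the body to touch [r], the number
    of passes is fixed on entry and [r] ends at 0. *)
Inductive cmd := CSkip | CInc of nat | CSeq of cmd & cmd | CLoop of nat & cmd.

Fixpoint sem (c : cmd) (s : state) : state :=
  match c with
  | CSkip => s
  | CInc r => upd s r (s r).+1
  | CSeq c d => sem d (sem c s)
  | CLoop r c => iter (s r) (fun s => sem c (upd s r (s r).-1)) s
  end.

Fixpoint touches (c : cmd) (r : nat) : bool :=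
  match c with
  | CSkip => false
  | CInc r' => r == r'
  | CSeq c d => touches c r || touches d r
  | CLoop r' c => (r == r') || touches c r
  end.

Fixpoint wf (c : cmd) : bool :=
  match c with
  | CSeq c d => wf c && wf d
  | CLoop r c => wf c && ~~ touches c r
  | _ => true
  end.

Lemma upd_ext s s' r v : s =1 s' -> upd s r v =1 upd s' r v.
Proof. by move=> H i; rewrite /upd H. Qed.

Lemma sem_ext c s s' : s =1 s' -> sem c s =1 sem c s'.
Proof.
elim: c s s' => [|r|c IHc d IHd|r c IH] s s' H //=.
- by rewrite H; apply: upd_ext.
- by apply: IHd; apply: IHc.
rewrite H; elim: (s' r) => //= n IHn.
by apply: IH; rewrite IHn; apply: upd_ext.
Qed.

Lemma sem_touches c s r : ~~ touches c r -> sem c s r = s r.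
Proof.
elim: c s => [|r'|c IHc d IHd|r' c IH] s //=.
- by rewrite /upd => /negbTE ->.
- by rewrite negb_or => /andP[Hc Hd]; rewrite IHd // IHc.
rewrite negb_or => /andP[Hr Hc]; elim: (s r') => //= n IHn.
by rewrite IH // /upd (negbTE Hr).
Qed.

Lemma loop_inv r c s (I : nat -> state) n : n = s r -> s =1 I 0 ->
  (forall k, k < n -> sem c (upd (I k) r (I k r).-1) =1 I k.+1) ->
  sem (CLoop r c) s =1 I n.
Proof.
move=> -> H0 HI /=; elim: {-2}(s r) (leqnn (s r)) => // k IHk Hk i /=.
rewrite -(HI k Hk i); apply: sem_ext => j; rewrite (IHk (ltnW Hk)).
by apply: upd_ext => j'; apply: IHk; apply: ltnW.
Qed.

Section Compile.
(* [Z] is a register that stays zero: [DEC Z o] is an unconditional jump. *)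
Variable Z : nat.

Fixpoint csize (c : cmd) : nat :=
  match c with
  | CSkip => 0
  | CInc _ => 1
  | CSeq c d => csize c + csize d
  | CLoop _ c => (csize c).+2
  end.

Fixpoint compile (c : cmd) (o : nat) : program :=
  match c with
  | CSkip => [::]
  | CInc r => [:: INC r]
  | CSeq c d => compile c o ++ compile d (o + csize c)
  | CLoop r c => DEC r (o + (csize c).+2) :: compile c o.+1 ++ [:: DEC Z o]
  end.

Lemma size_compile c o : size (compile c o) = csize c.
Proof.
elim: c o => //= [c IHc d IHd|r c IH] o; first by rewrite size_cat IHc IHd.
by rewrite size_cat IH /= addn1.
Qed.

Definition emb (Q : program) o (l : program) := exists p q, Q = p ++ l ++ q /\ size p = o.

Lemma emb_cat Q o l1 l2 : emb Q o (l1 ++ l2) -> emb Q o l1 /\ emb Q (o + size l1) l2.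
Proof.
move=> [p [q [-> <-]]]; split; first by exists p, (l2 ++ q); rewrite -catA.
by exists (p ++ l1), q; rewrite size_cat -!catA.
Qed.

Lemma emb_nth Q o i l : emb Q o (i :: l) -> o < size Q /\ nth (INC 0) Q o = i.
Proof.
move=> [p [q [-> <-]]]; rewrite size_cat /= addnS ltnS leq_addr.
by rewrite nth_cat ltnn subnn.
Qed.

Lemma compile_correct c Q o regs s : emb Q o (compile c o) -> wf c -> ~~ touches c Z ->
  rep regs s -> s Z = 0 ->
  exists2 regs', reach Q (o, regs) (o + csize c, regs') & rep regs' (sem c s).
Proof.
elim: c o regs s => [|r|c IHc d IHd|r c IH] o regs s /=.
- by exists regs; rewrite ?addn0 //; apply: reach_refl.
- move=> /emb_nth[Ho En] _ _ Hr _; exists (setreg regs r (reg regs r).+1).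
    by apply: reach_step; rewrite /= Ho En addn1.
  by rewrite Hr; apply: rep_set.
- move=> /emb_cat[Ec Ed] /andP[wc wd]; rewrite negb_or size_compile in Ed * => /andP[tc td] Hr HZ.
  have [regs1 R1 H1] := IHc _ _ _ Ec wc tc Hr HZ.
  have HZ1 : sem c s Z = 0 by rewrite sem_touches.
  have [regs2 R2 H2] := IHd _ _ _ Ed wd td H1 HZ1.
  by exists regs2 => //; rewrite addnA; apply: reach_trans R1 R2.
move=> E /andP[wc tr]; rewrite negb_or => /andP[Zr tc].
have [Ho En] := emb_nth E.
have [_ E'] := @emb_cat _ _ [:: _] _ E; rewrite /= addn1 in E'.
have [Ec Ej] := emb_cat E'; rewrite size_compile in Ej.
have [Ho' En'] := emb_nth Ej.
move=> Hr HZ; move: (erefl (s r)); move: {2 3}(s r) => n.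
elim: n s regs Hr HZ => [|n IHn] s regs Hr HZ Es /=.
  exists regs => //; apply: reach_step; rewrite /= Ho En Hr Es.
  by [].
have Hs : sem c (upd s r n) r = n by rewrite sem_touches // /upd eqxx.
have HZ0 : upd s r n Z = 0 by rewrite /upd (negbTE Zr).
have HZ' : sem c (upd s r n) Z = 0 by rewrite sem_touches.
have [regs1 R1 H1] := IH _ _ _ Ec wc tc (rep_set r n Hr) HZ0.
have [regs2 R2 H2] := IHn _ _ H1 HZ' Hs.
exists regs2; last first.
  change (rep regs2 (iter n.+1 (fun t => sem c (upd t r (t r).-1)) s)).
  by rewrite iterSr Es.
apply: reach_trans R2; apply: reach_trans (reach_trans R1 _); apply: reach_step.
  by rewrite /= Ho En Hr Es.
by rewrite /= Ho' En' H1 HZ'.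
Qed.

End Compile.

(** * Loop programs for the arithmetic of codes *)

Definition incn k r := iter k (CSeq (CInc r)) CSkip.
Definition mulc k r w := CSeq (CLoop r (incn k w)) (CLoop w (CInc r)).
(** The map [z -> 2 ^ a (2 z + 1)] is the one by which [code_seq] prepends [a] to a list with code
    [z]. *)
Definition affc a r w := CSeq (mulc 2 r w) (CSeq (CInc r) (mulc (2 ^ a) r w)).
Definition powc u v w := CSeq (CInc v) (CLoop u (mulc 2 v w)).
Definition affcs l r w := foldr (fun a c => CSeq c (affc a r w)) CSkip l.
Definition affs l z := foldr (fun a z => 2 ^ a * (2 * z).+1) z l.

Lemma sem_seq c d s s1 s2 : sem c s =1 s1 -> sem d s1 =1 s2 -> sem (CSeq c d) s =1 s2.
Proof. by move=> H1 H2 i; rewrite -H2 -(sem_ext d H1). Qed.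

Lemma touches_incn k r i : touches (incn k r) i = (0 < k) && (i == r).
Proof. by elim: k => //= k ->; case: (i == r); rewrite ?andbF. Qed.

Lemma wf_incn k r : wf (incn k r).
Proof. by elim: k. Qed.

Lemma sem_incn k r s : sem (incn k r) s =1 upd s r (s r + k).
Proof.
elim: k s => [|k IH] s i /=; first by rewrite addn0 /upd; case: eqP => [->|].
by rewrite IH /upd eqxx; case: eqP => //; lia.
Qed.

Lemma wf_mulc k r w : r != w -> wf (mulc k r w).
Proof. by move=> rw; rewrite /= wf_incn touches_incn /= (eq_sym w) negb_and rw !orbT. Qed.

Lemma sem_mulc k r w s : r != w -> s w = 0 -> sem (mulc k r w) s =1 upd s r (k * s r).
Proof.
move=> rw sw.
have H1 : sem (CLoop r (incn k w)) s =1 upd (upd s w (k * s r)) r 0.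
  pose I n := upd (upd s w (k * n)) r (s r - n).
  have -> : upd (upd s w (k * s r)) r 0 = I (s r) by rewrite /I subnn.
  apply: loop_inv => // [i|n Hn i].
    by rewrite /I /upd muln0 subn0; do 2 case: eqP => [->|_] //.
  rewrite sem_incn /I /upd eqxx (eq_sym w r) (negbTE rw) eqxx.
  by rewrite ?mulnS; case: (eqVneq i r) => [->|ir]; rewrite ?(negbTE rw); [|case: eqP]; lia.
set s1 := upd (upd s w (k * s r)) r 0 in H1.
have s1w : s1 w = k * s r by rewrite /s1 /upd (eq_sym w r) (negbTE rw) eqxx.
have H2 : sem (CLoop w (CInc r)) s1 =1 upd s r (k * s r).
  pose I n := upd (upd s r n) w (k * s r - n).
  move=> i; have -> : upd s r (k * s r) i = I (k * s r) i.
    by rewrite /I subnn /upd; case: (eqVneq i w) => // ->; rewrite (eq_sym w r) (negbTE rw).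
  apply: loop_inv i => // [i|n Hn i].
    by rewrite /I /s1 /upd subn0; case: (eqVneq i w) => [->|//]; rewrite (eq_sym w r) (negbTE rw).
  rewrite /I /= /upd eqxx (negbTE rw) eqxx.
  by case: (eqVneq i w) => [->|iw]; rewrite ?(eq_sym w r) ?(negbTE rw); [|case: eqP]; lia.
exact: sem_seq H1 H2.
Qed.

Lemma wf_affc a r w : r != w -> wf (affc a r w).
Proof. by move=> rw; rewrite /affc /wf -/wf !wf_mulc. Qed.

Lemma sem_affc a r w s : r != w -> s w = 0 ->
  sem (affc a r w) s =1 upd s r (2 ^ a * (2 * s r).+1).
Proof.
move=> rw sw; apply: sem_seq (sem_mulc 2 rw sw) _.
have E : sem (CInc r) (upd s r (2 * s r)) =1 upd s r (2 * s r).+1.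
  by move=> i; rewrite /= /upd eqxx; case: eqP.
apply: sem_seq E _ => i; rewrite sem_mulc // /upd.
  by rewrite eqxx; case: eqP.
by rewrite (eq_sym w r) (negbTE rw).
Qed.

Lemma wf_affcs l r w : r != w -> wf (affcs l r w).
Proof. by move=> rw; elim: l => // a l IH; rewrite /affcs [foldr _ _ _]/= /wf -/wf IH wf_affc. Qed.

Lemma sem_affcs l r w s : r != w -> s w = 0 -> sem (affcs l r w) s =1 upd s r (affs l (s r)).
Proof.
move=> rw sw; elim: l => [|a l IH] i.
  by rewrite /= /upd; case: eqP => [->|].
apply: (sem_seq IH) i => i; rewrite sem_affc // /upd.
  by rewrite eqxx; case: eqP.
by rewrite (eq_sym w r) (negbTE rw).
Qed.

Lemma sem_powloop u v w s : u != v -> v != w -> u != w -> s w = 0 ->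
  sem (CLoop u (mulc 2 v w)) s =1 upd (upd s v (2 ^ s u * s v)) u 0.
Proof.
move=> uv vw uw sw.
pose I n := upd (upd s v (2 ^ n * s v)) u (s u - n).
have -> : upd (upd s v (2 ^ s u * s v)) u 0 = I (s u) by rewrite /I subnn.
apply: loop_inv => // [i|n Hn i].
  by rewrite /I /upd mul1n subn0; do 2 case: eqP => [->|_] //.
rewrite sem_mulc // /I /upd; last by rewrite (eq_sym w u) (eq_sym w v) (negbTE uw) (negbTE vw).
rewrite eqxx (eq_sym v u) (negbTE uv) eqxx expnS mulnA.
case: (eqVneq i v) => [->|_]; first by rewrite (eq_sym v u) (negbTE uv).
by case: eqP => // _; lia.
Qed.

Lemma sem_powc u v w s : u != v -> v != w -> u != w -> s v = 0 -> s w = 0 ->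
  sem (powc u v w) s =1 upd (upd s v (2 ^ s u)) u 0.
Proof.
move=> uv vw uw sv sw; apply: (@sem_seq _ _ _ (upd s v 1)) => i.
  by rewrite /= sv.
rewrite sem_powloop //.
  by rewrite /upd eqxx (negbTE uv) muln1; case: (i == u); case: (i == v).
by rewrite /upd (eq_sym w v) (negbTE vw).
Qed.

(** * The diagonal machine *)

Section Diagonal.
Variables (P : program) (K14 KF : seq nat).

Let z := nregs P.
Let v := z.+1.
Let w := z.+2.
Let t := z.+3.
Let Z := z.+4.

(** The copy of the input in [z] becomes the code of the input matrix, the one in [t] the code of
    the remaining list. All work registers lie beyond those of [P] and end at 0, so [P] then starts
    as on a fresh input. *)
Definition encc : cmd :=
  CSeq (CLoop 0 (CSeq (CInc z) (CInc t)))
  (CSeq (powc z v w) (CSeq (mulc 10 v w) (CSeq (powc v z w) (CSeq (mulc 9 z w)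
  (CSeq (affcs K14 z w) (CSeq (affcs KF t w) (CSeq (mulc 2 t w) (CSeq (CInc t)
  (CSeq (CLoop z (mulc 2 t w)) (CLoop t (CInc 0))))))))))).

(** With [X = 2 ^ x], the number [9 * 2 ^ (10 * X)] codes the last two entries [5 X] and 1 of the
    input matrix: [code_int] turns them into [10 X] and 2, and [9 = 2 * 2 ^ 2 + 1]. *)
Definition encv (x : nat) : nat :=
  2 ^ affs K14 (9 * 2 ^ (10 * 2 ^ x)) * (2 * affs KF x).+1.

Definition st (a b c e : nat) : state := fun i =>
  if i == 0 then a else if i == z then b else if i == v then c else if i == t then e else 0.

Let z0 : (z == 0) = false. Proof. by []. Qed.
Let v0 : (v == 0) = false. Proof. by []. Qed.
Let w0 : (w == 0) = false. Proof. by []. Qed.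
Let t0 : (t == 0) = false. Proof. by []. Qed.
Let vz : (v == z) = false. Proof. by rewrite /v; lia. Qed.
Let wz : (w == z) = false. Proof. by rewrite /w; lia. Qed.
Let wv : (w == v) = false. Proof. by rewrite /w /v; lia. Qed.
Let wt : (w == t) = false. Proof. by rewrite /w /t; lia. Qed.
Let tz : (t == z) = false. Proof. by rewrite /t; lia. Qed.
Let tv : (t == v) = false. Proof. by rewrite /t /v; lia. Qed.
Let Zz : (Z == z) = false. Proof. by rewrite /Z; lia. Qed.
Let Zv : (Z == v) = false. Proof. by rewrite /Z /v; lia. Qed.
Let Zt : (Z == t) = false. Proof. by rewrite /Z /t; lia. Qed.
Let Zw : (Z == w) = false. Proof. by rewrite /Z /w; lia. Qed.

Lemma upd_st0 a b c e x : upd (st a b c e) 0 x =1 st x b c e.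
Proof. by move=> i; rewrite /upd /st; case: eqP. Qed.
Lemma upd_stz a b c e x : upd (st a b c e) z x =1 st a x c e.
Proof. by move=> i; rewrite /upd /st; case: (eqVneq i z) => [->|//]; rewrite z0. Qed.
Lemma upd_stv a b c e x : upd (st a b c e) v x =1 st a b x e.
Proof. by move=> i; rewrite /upd /st; case: (eqVneq i v) => [->|//]; rewrite v0 vz. Qed.
Lemma upd_stt a b c e x : upd (st a b c e) t x =1 st a b c x.
Proof. by move=> i; rewrite /upd /st; case: (eqVneq i t) => [->|//]; rewrite t0 tz tv. Qed.

Lemma st_z a b c e : st a b c e z = b. Proof. by rewrite /st z0 eqxx. Qed.
Lemma st_v a b c e : st a b c e v = c. Proof. by rewrite /st v0 vz eqxx. Qed.
Lemma st_t a b c e : st a b c e t = e. Proof. by rewrite /st t0 tz tv eqxx. Qed.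
Lemma st_w a b c e : st a b c e w = 0. Proof. by rewrite /st w0 wz wv wt. Qed.
Lemma st_Z a b c e : st a b c e Z = 0. Proof. by rewrite /st /= Zz Zv Zt. Qed.

Lemma inc_z a b c e : sem (CInc z) (st a b c e) =1 st a b.+1 c e.
Proof. by move=> i; rewrite /= upd_stz st_z. Qed.
Lemma inc_t a b c e : sem (CInc t) (st a b c e) =1 st a b c e.+1.
Proof. by move=> i; rewrite /= upd_stt st_t. Qed.
Lemma inc_0 a b c e : sem (CInc 0) (st a b c e) =1 st a.+1 b c e.
Proof. by move=> i; rewrite /= upd_st0. Qed.

Lemma upd_st2 r r' x x' s s1 s2 : upd s r x =1 s1 -> upd s1 r' x' =1 s2 ->
  upd (upd s r x) r' x' =1 s2.
Proof. by move=> H1 H2 i; rewrite -H2; apply: upd_ext. Qed.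

Let nzv : z != v. Proof. by rewrite eq_sym vz. Qed.
Let nvz : v != z. Proof. by rewrite vz. Qed.
Let nzw : z != w. Proof. by rewrite eq_sym wz. Qed.
Let nvw : v != w. Proof. by rewrite eq_sym wv. Qed.
Let ntw : t != w. Proof. by rewrite eq_sym wt. Qed.
Let nzt : z != t. Proof. by rewrite eq_sym tz. Qed.

Lemma sem_copy x : sem (CLoop 0 (CSeq (CInc z) (CInc t))) (st x 0 0 0) =1 st 0 x 0 x.
Proof.
pose I n := st (x - n) n 0 n.
have -> : st 0 x 0 x = I x by rewrite /I subnn.
apply: loop_inv => // [i|n Hn]; first by rewrite /I subn0.
apply: (@sem_seq _ _ _ (st (x - n.+1) n.+1 0 n)) => [i|i]; last exact: inc_t.
rewrite -inc_z; apply: sem_ext => j; rewrite upd_st0; congr (st _ _ _ _ _).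
by rewrite /I /st /= subnS.
Qed.

Lemma sem_powc_zv a b d : sem (powc z v w) (st a b 0 d) =1 st a 0 (2 ^ b) d.
Proof.
move=> i; rewrite sem_powc ?st_v ?st_w // st_z.
by rewrite (upd_st2 (upd_stv _ _ _ _ _) (upd_stz _ _ _ _ _)).
Qed.

Lemma sem_powc_vz a c d : sem (powc v z w) (st a 0 c d) =1 st a (2 ^ c) 0 d.
Proof.
move=> i; rewrite sem_powc ?st_z ?st_w // st_v.
by rewrite (upd_st2 (upd_stz _ _ _ _ _) (upd_stv _ _ _ _ _)).
Qed.

Lemma sem_mulc_z k a b c d : sem (mulc k z w) (st a b c d) =1 st a (k * b) c d.
Proof. by move=> i; rewrite sem_mulc ?st_w // upd_stz st_z. Qed.

Lemma sem_mulc_v k a b c d : sem (mulc k v w) (st a b c d) =1 st a b (k * c) d.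
Proof. by move=> i; rewrite sem_mulc ?st_w // upd_stv st_v. Qed.

Lemma sem_mulc_t k a b c d : sem (mulc k t w) (st a b c d) =1 st a b c (k * d).
Proof. by move=> i; rewrite sem_mulc ?st_w // upd_stt st_t. Qed.

Lemma sem_affcs_z l a b c d : sem (affcs l z w) (st a b c d) =1 st a (affs l b) c d.
Proof. by move=> i; rewrite sem_affcs ?st_w // upd_stz st_z. Qed.

Lemma sem_affcs_t l a b c d : sem (affcs l t w) (st a b c d) =1 st a b c (affs l d).
Proof. by move=> i; rewrite sem_affcs ?st_w // upd_stt st_t. Qed.

Lemma sem_powloop_zt a b c d :
  sem (CLoop z (mulc 2 t w)) (st a b c d) =1 st a 0 c (2 ^ b * d).
Proof.
move=> i; rewrite sem_powloop ?st_w // st_z st_t.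
by rewrite (upd_st2 (upd_stt _ _ _ _ _) (upd_stz _ _ _ _ _)).
Qed.

Lemma sem_output N : sem (CLoop t (CInc 0)) (st 0 0 0 N) =1 st N 0 0 0.
Proof.
pose I n := st n 0 0 (N - n).
have -> : st N 0 0 0 = I N by rewrite /I subnn.
apply: loop_inv => [|i|n Hn i]; rewrite ?st_t // /I ?subn0 //.
rewrite -inc_0; apply: sem_ext => j; rewrite upd_stt; congr (st _ _ _ _ _).
by rewrite st_t subnS.
Qed.

Lemma sem_encc x : sem encc (st x 0 0 0) =1 st (encv x) 0 0 0.
Proof.
apply: sem_seq (sem_copy x) _.
apply: sem_seq (sem_powc_zv _ _ _) _.
apply: sem_seq (sem_mulc_v _ _ _ _ _) _.
apply: sem_seq (sem_powc_vz _ _ _) _.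
apply: sem_seq (sem_mulc_z _ _ _ _ _) _.
apply: sem_seq (sem_affcs_z _ _ _ _ _) _.
apply: sem_seq (sem_affcs_t _ _ _ _ _) _.
apply: sem_seq (sem_mulc_t _ _ _ _ _) _.
apply: sem_seq (inc_t _ _ _ _) _.
apply: sem_seq (sem_powloop_zt _ _ _ _) _.
exact: sem_output.
Qed.

Lemma untouched_encc : ~~ touches encc Z.
Proof.
have tS c d : ~~ touches c Z -> ~~ touches d Z -> ~~ touches (CSeq c d) Z.
  by move=> Hc Hd; rewrite /= (negbTE Hc).
have tL r c : Z != r -> ~~ touches c Z -> ~~ touches (CLoop r c) Z.
  by move=> Hr Hc; rewrite /= (negbTE Hr).
have tI r : Z != r -> ~~ touches (CInc r) Z by [].
have tM k r r' : Z != r -> Z != r' -> ~~ touches (mulc k r r') Z.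
  by move=> ir ir'; rewrite /= !touches_incn (negbTE ir) (negbTE ir') !andbF.
have tA l r r' : Z != r -> Z != r' -> ~~ touches (affcs l r r') Z.
  move=> ir ir'; elim: l => // a l IH; apply: (tS _ _ IH).
  by apply: (tS _ _ (tM _ _ _ ir ir')); apply: (tS _ _ (tI _ ir)); apply: (tM).
have Z0 : Z != 0 by [].
have [Zz' Zv' Zw' Zt'] : [/\ Z != z, Z != v, Z != w & Z != t] by rewrite Zz Zv Zw Zt.
by repeat first [assumption | apply tM | apply tA | apply tS | apply tL | apply tI].
Qed.

Lemma wf_encc : wf encc.
Proof.
have wS c d : wf c -> wf d -> wf (CSeq c d) by move=> Hc Hd; rewrite /= Hc.
have wL r c : wf c -> ~~ touches c r -> wf (CLoop r c) by move=> Hc Hr; rewrite /= Hc.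
have tM k r r' i : i != r -> i != r' -> ~~ touches (mulc k r r') i.
  by move=> ir ir'; rewrite /= touches_incn (negbTE ir) (negbTE ir') !andbF.
have [zv' zw' zt' vw' tw'] : [/\ z != v, z != w, z != t, v != w & t != w].
  by rewrite eq_sym vz (eq_sym z) wz (eq_sym z) tz (eq_sym v) wv (eq_sym t) wt.
have vz' : v != z by rewrite vz.
by repeat first [assumption | apply wf_mulc | apply wf_affcs | apply wS | apply wL | apply tM].
Qed.

Definition shift_instr o (i : instr) : instr :=
  match i with INC r => INC r | DEC r j => DEC r (o + minn j (size P)) end.

Let o := csize encc.
Let e := o + size P.

(** When [P] has stopped, output 0 jumps past the end and halts, while a positive output falls into
    an endless self-jump on the zero register [Z]. *)
Definition diag : program :=
  compile Z encc 0 ++ map (shift_instr o) P ++ [:: DEC 0 e.+2; DEC Z e.+1].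

Lemma size_diag : size diag = e.+2.
Proof. by rewrite /diag size_cat size_compile size_cat size_map addnA addn2. Qed.

Lemma diag_P pc : pc < size P -> nth (INC 0) diag (o + pc) = shift_instr o (nth (INC 0) P pc).
Proof.
move=> Hpc; rewrite /diag nth_cat size_compile ltnNge leq_addr /= addKn nth_cat size_map Hpc.
by rewrite (nth_map (INC 0)).
Qed.

Lemma diag_end i : nth (INC 0) diag (e + i) = nth (INC 0) [:: DEC 0 e.+2; DEC Z e.+1] i.
Proof.
rewrite /diag nth_cat size_compile /e -addnA ltnNge leq_addr /= addKn nth_cat size_map.
by rewrite ltnNge leq_addr /= addKn.
Qed.

Definition same (r1 r2 : seq nat) := reg r1 =1 reg r2.

Lemma same_set r1 r2 i x : same r1 r2 -> same (setreg r1 i x) (setreg r2 i x).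
Proof. by move=> H j; rewrite !reg_setreg H. Qed.

Lemma diag_run n c regs : same c.2 regs -> exists2 regs', same (run P n c).2 regs' &
  reach diag (o + minn c.1 (size P), regs) (o + minn (run P n c).1 (size P), regs').
Proof.
elim: n c regs => [|n IH] [pc r] regs Hs /=; first by exists regs => //; apply: reach_refl.
case Hpc: (pc < size P); last by exists regs => //; apply: reach_refl.
have Hm : minn pc (size P) = pc by apply/minn_idPl/ltnW.
have Hd : o + pc < size diag by rewrite size_diag ltnS leqW // leq_add2l ltnW.
have Hn := diag_P Hpc.
have Hm1 : minn pc.+1 (size P) = pc.+1 by apply/minn_idPl.
rewrite Hm; case Ei: (nth _ P pc) Hn => [i|i j] Hn; last case Er: (reg r i) => [|k].
- have [regs' H1 H2] := IH (pc.+1, setreg r i (reg r i).+1) _ (same_set i (reg r i).+1 Hs).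
  exists regs' => //. apply: reach_trans H2; apply: reach_step.
  by rewrite (step_at _ Hd Hn) /= -Hs Hm1 addnS.
- have [regs' H1 H2] := IH (j, r) _ Hs.
  by exists regs' => //; apply: reach_trans H2; apply: reach_step; rewrite (step_at _ Hd Hn) /= -Hs Er.
- have [regs' H1 H2] := IH (pc.+1, setreg r i k) _ (same_set i k Hs).
  exists regs' => //; apply: reach_trans H2; apply: reach_step.
  by rewrite (step_at _ Hd Hn) /= -Hs Er Hm1 addnS.
Qed.

Lemma run_untouched n c i : z <= i -> reg (run P n c).2 i = reg c.2 i.
Proof.
move=> Hi; elim: n c => //= n IH c; case E: (step P c) => [c'|] //; rewrite IH.
case: c E => pc r; rewrite /step; case: ltnP => // Hpc.
have := instr_reg_lt Hpc; rewrite /instr_at.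
case: (nth _ _ _) => [j|j k] /= Hj.
  by move=> [<-] /=; rewrite reg_setreg gtn_eqF // (leq_trans Hj Hi).
by case: (reg r j) => [|n'] [<-] //=; rewrite reg_setreg gtn_eqF // (leq_trans Hj Hi).
Qed.

Lemma diag_spec x y : halts_with P (encv x) y -> halts diag (0, [:: x]) <-> y = 0.
Proof.
move=> [n]; set c := run P n _ => -[Hc Hy].
have Hemb : emb diag 0 (compile Z encc 0).
  by exists [::], (map (shift_instr o) P ++ [:: DEC 0 e.+2; DEC Z e.+1]).
have Hst y' : rep [:: y'] (st y' 0 0 0).
  by move=> [|i]; rewrite /reg /st //= nth_nil; rewrite !if_same.
have [regs1 R1 H1] := compile_correct Hemb wf_encc untouched_encc (Hst x) (st_Z _ _ _ _).
have S1 : same [:: encv x] regs1 by move=> i; rewrite H1 sem_encc Hst.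
have [regs2 S2 R2] := diag_run n (c := (0, [:: encv x])) S1.
rewrite -/c in S2 R2.
have Hpc : minn c.1 (size P) = size P.
  by case: (c) Hc => pc r /code_halt; rewrite /mhl code_pc => /eqP.
rewrite min0n addn0 Hpc -/e in R2.
have R : reach diag (0, [:: x]) (e, regs2) by apply: reach_trans R1 R2.
have Z2 : reg regs2 Z = 0.
  rewrite -S2 /c run_untouched; first by [].
  by rewrite /Z; do 4 apply: leqW.
rewrite (halts_reach R); have He : e < size diag by rewrite size_diag.
have N0 : nth (INC 0) diag e = DEC 0 e.+2 by have D := diag_end 0; rewrite addn0 in D.
have N1 : nth (INC 0) diag e.+1 = DEC Z e.+1 by have D := diag_end 1; rewrite addn1 in D.
have Es : step diag (e, regs2) =
    if y is k.+1 then Some (e.+1, setreg regs2 0 k) else Some (e.+2, regs2).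
  by rewrite (step_at _ He N0) -S2 Hy.
case: y Hy Es => [|k] Hy Es.
  by split=> // _; exists 1; rewrite (runS _ Es) /step /run size_diag ltnn.
split=> // -[m Hm]; exfalso; move: Hm.
case: m => [|m]; first by rewrite /run Es.
rewrite (runS _ Es); set r := setreg _ _ _.
have Er : step diag (e.+1, r) = Some (e.+1, r).
  by rewrite (step_at _ _ N1) ?size_diag // reg_setreg Z2.
suff -> : run diag m (e.+1, r) = (e.+1, r) by rewrite Er.
by elim: m => // m IH; rewrite (runS _ Er).
Qed.

End Diagonal.

(** * The matrices *)

Definition gen_enc (g : gen) : nat * nat :=
  match g with
  | GI => (0, 0) | GPush x => (1, x) | GTurn => (2, 0) | GPopK x => (3, x)
  | GPopD x => (4, x) | GLoop b => (5, nat_of_bool b)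
  end.
Definition gen_dec (p : nat * nat) : gen :=
  match p with
  | (0, _) => GI | (1, x) => GPush x | (2, _) => GTurn | (3, x) => GPopK x
  | (4, x) => GPopD x | (_, b) => GLoop (b == 1)
  end.
Lemma gen_encK : cancel gen_enc gen_dec.
Proof. by case=> // -[]. Qed.
HB.instance Definition _ := Equality.copy gen (can_type gen_encK).

(** * Exponent sums, which tell the matrices apart *)

Section Exponents.
Local Open Scope ring_scope.

Definition estep (j : nat) (l : letter) (e : int) : int :=
  e + sgb l.2 * (l.1 == j)%:Z.

Definition expo (j : nat) (w : seq letter) : int := foldr (estep j) 0 w.

Lemma estepK j l e : estep j l (estep j (linv l) e) = e.
Proof. by case: l => i []; rewrite /estep /linv /sgb /=; case: (i == j); lia. Qed.

Lemma wmat_expo j u v : wmat u = wmat v -> expo j u = expo j v.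
Proof.
move=> E; have H z w : wmat w = 1 -> foldr (estep j) z w = z.
  by apply: wmat1_foldr => l a; apply: estepK.
have Z' : foldr (estep j) (expo j v) (winv v) = 0.
  by rewrite /expo -foldr_cat H // wmat_cat wmatKl.
have := H (expo j v) (u ++ winv v); rewrite wmat_cat E wmatKr => /(_ erefl).
by rewrite foldr_cat Z'.
Qed.

Lemma expo_cat j u v : expo j (u ++ v) = expo j u + expo j v.
Proof. by elim: u => [|l u IH] /=; rewrite ?add0r // /expo /= -!/(expo j _) IH /estep addrAC. Qed.

Lemma expo_cons j l w : expo j (l :: w) = sgb l.2 * (l.1 == j)%:Z + expo j w.
Proof. by rewrite /expo /= /estep addrC. Qed.

Lemma expo_nseq j n l : expo j (nseq n l) = n%:Z * (sgb l.2 * (l.1 == j)%:Z).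
Proof. by elim: n => [|n IH]; [rewrite mul0r | rewrite expo_cons IH intS mulrDl mul1r]. Qed.

Lemma expo_tp j t k : expo j (tp t k) = k * (t == j)%:Z.
Proof. by case: k => n; rewrite expo_nseq /sgb /= ?mul1r // NegzE mulN1r mulrN mulNr. Qed.

End Exponents.

Arguments expo : simpl never.

Lemma mulmx_diag_block (A A' D D' : 'M[int]_2) :
  (block_mx A 0 0 D *m block_mx A' 0 0 D' = block_mx (A * A') 0 0 (D * D'))%R.
Proof. by rewrite mulmx_block !mul0mx !mulmx0 !addr0 !add0r. Qed.

Section Generators.
Variables (M : nat) (app : nat -> seq nat) (S X : nat) (pre : seq nat).

Definition gmat (g : gen) : 'M[int]_4 :=
  (block_mx (wmat (w1 M S g)) 0 0 (wmat (w2 app X pre g)) : 'M[int]_(2 + 2))%R.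

Definition fixed_gens := GTurn :: map GPopK (iota 0 6) ++ map GPopD (iota 0 6).
Definition program_gens := map GPush (iota 0 6) ++ [:: GLoop false; GLoop true].
Definition all_gens := GI :: fixed_gens ++ program_gens.

Definition pad_mx (k : nat) : 'M[int]_4 := ((k%:Z)%:M)%R.
(* Padding: no product equal to the identity contains a multiple of it by an integer at least 2. *)
Definition pads := map pad_mx (iota 2 26).

(** The order serves the coding: with the input matrix first and the program matrices last, the code
    has the shape of [encv]. There are 22 generators and 26 paddings. *)
Definition mats := gmat GI :: (map gmat fixed_gens ++ pads) ++ map gmat program_gens.

Lemma size_mats : size mats = 48.
Proof. by []. Qed.

Lemma gmat_prod gs : (\prod_(g <- gs) gmat g =
  (block_mx (wmat (ww1 M S gs)) 0 0 (wmat (ww2 app X pre gs)) : 'M[int]_(2 + 2)))%R.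
Proof.
elim: gs => [|g gs IH]; first by rewrite big_nil !wmat_nil -scalar_mx_block.
rewrite big_cons IH /ww1 /ww2 /= !wmat_cat -!/(ww1 _ _ _) -!/(ww2 _ _ _ _).
exact: mulmx_diag_block.
Qed.

Lemma gmat_prod1 gs : (\prod_(g <- gs) gmat g = 1%:M)%R <->
  (wmat (ww1 M S gs) = 1 /\ wmat (ww2 app X pre gs) = 1)%R.
Proof.
rewrite gmat_prod (scalar_mx_block 2 2); split.
  by move=> H; have [] := @eq_block_mx _ 2 2 2 2 _ _ _ _ _ _ _ _ H.
by move=> [-> ->].
Qed.

Lemma pad_prod k (s : seq 'M[int]_4) : 1 < k -> pad_mx k \in s -> (\prod_(A <- s) A)%R <> 1%:M%R.
Proof.
move=> k1 /splitPr[s1 s2]; rewrite big_cat big_cons /=.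
have -> B : (pad_mx k * B = k%:Z *: B)%R by apply: mul_scalar_mx.
(* All entries of the product are multiples of [k], so the one at [(0, 0)] is not 1. *)
rewrite -scalerAr => /matrixP/(_ 0 0)%R; rewrite mxE [in RHS]mxE /=.
move=> /(congr1 absz); rewrite abszM /= => /eqP; rewrite muln_eq1 => /andP[/eqP Ek _].
by rewrite Ek in k1.
Qed.

Lemma gok_all g : gok g -> g \in all_gens.
Proof.
by case: g => [|x||x|x|[]] //; move: x => [|[|[|[|[|[|x]]]]]].
Qed.

Lemma all_gok g : g \in all_gens -> gok g.
Proof. by move: g; apply/allP. Qed.

Lemma gmat_mem g : gok g -> gmat g \in mats.
Proof.
move/gok_all; rewrite (in_cons GI) (mem_cat _ fixed_gens) => /orP[/eqP->|/orP[H|H]];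
  rewrite (in_cons (gmat GI)) (mem_cat _ (_ ++ pads)) (mem_cat _ (map gmat fixed_gens)).
- by rewrite eqxx.
- by rewrite (map_f gmat H) ?orbT.
- by rewrite (map_f gmat H) !orbT.
Qed.

Lemma mem_mats A : A \in mats -> (exists2 g, gok g & A = gmat g) \/ exists2 k, 1 < k & A = pad_mx k.
Proof.
rewrite (in_cons (gmat GI)) (mem_cat _ (_ ++ pads)) (mem_cat _ (map gmat fixed_gens)).
move=> /orP[/eqP->|/orP[/orP[/mapP[g Hg ->]|/mapP[k]]|/mapP[g Hg ->]]].
- by left; exists GI.
- by left; exists g => //; apply: all_gok; rewrite (in_cons GI) (mem_cat _ fixed_gens) Hg orbT.
- by rewrite mem_iota => /andP[k1 _] ->; right; exists k.
- by left; exists g => //; apply: all_gok; rewrite (in_cons GI) (mem_cat _ fixed_gens) Hg !orbT.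
Qed.

Lemma identity_mats : identity_in_semigroup mats <->
  exists gs, [/\ all gok gs, gs <> [::], wmat (ww1 M S gs) = 1%R & wmat (ww2 app X pre gs) = 1%R].
Proof.
split=> [[s [s0 Hs Hp]]|[gs [ok gs0 H1 H2]]]; last first.
  exists (map gmat gs); split.
  - by case: (gs) gs0.
  - by rewrite all_map; apply: sub_all ok => g /gmat_mem.
  - by rewrite big_map; apply/gmat_prod1.
have [gs ok Es] : exists2 gs, all gok gs & s = map gmat gs.
  have np k : 1 < k -> pad_mx k \notin s by move=> k1; apply/negP => /(pad_prod k1).
  elim: s {s0 Hp} Hs np => [|A s IH] /=; first by exists [::].
  move=> /andP[HA Hs] np; case: (mem_mats HA) => [[g okg EA]|[k k1 EA]]; last first.
    by have := np k k1; rewrite EA inE eqxx.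
  have [k k1|gs ok Es] := IH Hs; first by have := np k k1; rewrite inE negb_or => /andP[].
  by exists (g :: gs); rewrite /= ?okg // EA Es.
exists gs; move: Hp; rewrite Es big_map => /gmat_prod1[H1 H2].
by split=> //; case: gs Es {ok H1 H2} s0 => // ->.
Qed.

Definition expo1 (j : nat) (g : gen) : int :=
  (match g with
  | GI => (j == 7)%:Z | GPush x => (j == x)%:Z | GTurn => - (j == 8)%:Z
  | GPopK x => - (j == x)%:Z | GPopD _ => 0
  | GLoop b => (j == 8)%:Z - S%:Z * (j == 7)%:Z + kloop b * (j == 9)%:Z
  end)%R.

(** The letter 6 is left out because its count in a push depends on [M]. *)
Lemma expo_w1 j g : j != 6 -> expo j (w1 M S g) = expo1 j g.
Proof.
move=> j6; have Ep b : expo j [:: (8, b)] = (sgb b * (j == 8)%:Z)%R.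
  by rewrite expo_cons addr0 eq_sym.
case: g => [|x||x|x|b] /=.
- by rewrite expo_cons /= addr0 mul1r eq_sym.
- rewrite /pw /= map_nseq expo_cons expo_nseq /= (eq_sym 6) (negbTE j6) !mulr0 addr0 mul1r.
  by rewrite eq_sym.
- by rewrite Ep /sgb mulN1r.
- rewrite !expo_cons /= /expo /= (eq_sym 8) (eq_sym x) /sgb !mul1r !mulN1r addr0.
  by rewrite addrCA subrr addr0.
- rewrite !expo_cons /= /expo /= (eq_sym 8) (eq_sym 6) (negbTE j6) /sgb !mul1r !mulN1r addr0 oppr0.
  by rewrite add0r subrr.
- rewrite -cat_cons expo_cat expo_tp expo_cons expo_nseq /= /sgb mul1r mulN1r mulrN.
  by rewrite (eq_sym 8) (eq_sym 7) (eq_sym 9).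
Qed.

(** First-component exponents separate all generators except the various [GPopD x] from each other;
    these differ in the second component. *)
Lemma gmat_inj : {in all_gens &, injective gmat}.
Proof.
move=> g g' /all_gok okg /all_gok okg' H.
have {H} [E1 _ _ E2] := @eq_block_mx _ 2 2 2 2 _ _ _ _ _ _ _ _ H.
have H j : j != 6 -> expo1 j g = expo1 j g'.
  by move=> j6; rewrite -!expo_w1 //; apply: wmat_expo.
have H2 j : expo j (w2 app X pre g) = expo j (w2 app X pre g') by apply: wmat_expo.
have H7 := H 7 isT; have H8 := H 8 isT; have H9 := H 9 isT.
have Hx x : x < 6 -> expo1 x g = expo1 x g' by move=> x6; apply: H; lia.
case: g okg {H E1 E2} H2 H7 H8 H9 Hx => [|x||x|x|b] okg;
  case: g' okg' => [|x'||x'|x'|b'] okg' H2 H7 H8 H9 Hx //.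
all: try (have Hx1 := Hx x okg); try (have Hx2 := Hx x' okg').
all: try (exfalso; move: okg okg' H7 H8 H9 Hx1 Hx2 => /=; lia).
all: try (exfalso; move: okg H7 H8 H9 Hx1 => /=; lia).
all: try (exfalso; move: okg' H7 H8 H9 Hx2 => /=; lia).
all: try (exfalso; move: H7 H8 H9 => /=; lia).
- by congr GPush; move: Hx1 => /=; lia.
- by congr GPopK; move: Hx1 => /=; lia.
- by congr GPopD; have := H2 x; rewrite !expo_cons /= /sgb; lia.
- by move: H9; rewrite /expo1 /kloop /= mulr0; case: (b); case: (b') => // ?; lia.
Qed.

(** [gmat g] has an integer inverse, whereas [k] times the identity has none. *)
Lemma gmat_pad g k : 1 < k -> gmat g <> pad_mx k.
Proof.
move=> k1 E.
pose D : 'M[int]_4 := (block_mx (wmat (winv (w1 M S g))) 0 0 (wmat (winv (w2 app X pre g)))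
  : 'M[int]_(2 + 2))%R.
apply: (@pad_prod k [:: pad_mx k; D]) => //; first exact: mem_head.
rewrite !big_cons big_nil mulr1 -E.
by apply: etrans (mulmx_diag_block _ _ _ _) _; rewrite !wmatKr -scalar_mx_block.
Qed.

Lemma pad_mx_inj : injective pad_mx.
Proof. by move=> k k' /matrixP/(_ 0 0)%R; rewrite !mxE /= => -[]. Qed.

Lemma uniq_mats : uniq mats.
Proof.
have -> : uniq mats = uniq (map gmat all_gens ++ pads).
  apply: perm_uniq; rewrite /mats /all_gens map_cons map_cat cat_cons perm_cons.
  by rewrite -!catA perm_cat2l perm_catC.
rewrite cat_uniq (map_inj_in_uniq gmat_inj) (map_inj_uniq pad_mx_inj) iota_uniq andbT.
apply/andP; split; first by [].
apply/hasP => -[A /mapP[k Hk ->] /mapP[g _ E]].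
by move: Hk; rewrite mem_iota => /andP[k1 _]; apply: (gmat_pad k1 (esym E)).
Qed.

(* The codes of the entries of the input matrix preceding the one that depends on the input. *)
Definition K14 : seq nat :=
  let A := wmat [:: (7, true)] in
  [seq code_int a | a <- [:: A 0 0; A 0 1; 0; 0; A 1 0; A 1 1; 0; 0; 0; 0; 1; 0; 0; 0]%R].

Lemma code_seq_cons a l : code_seq (a :: l) = 2 ^ a * (2 * code_seq l).+1.
Proof. by rewrite /= /npair prednK ?mul2n // muln_gt0 expn_gt0. Qed.

Lemma code_seq_cat l l' : code_seq (l ++ l') = affs l (code_seq l').
Proof. by elim: l => // a l IH; rewrite cat_cons code_seq_cons IH. Qed.

(** The letter 0 gives a lower triangular block, so in row-major order only the entry of index 14,
    equal to [5 X], depends on [X]. *)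
Lemma code_input : code_mx (gmat GI) = affs K14 (9 * 2 ^ (10 * X)).
Proof.
have E : enum 'I_4 = [:: lshift 2 0; lshift 2 1; rshift 2 0; rshift 2 1]%R.
  by apply: (inj_map val_inj); rewrite val_enum_ord.
rewrite /code_mx E [flatten _]/=.
have ul (i j : 'I_2) : gmat GI (lshift 2 i) (lshift 2 j) = wmat (w1 M S GI) i j by apply: block_mxEul.
have ur (i j : 'I_2) : gmat GI (lshift 2 i) (rshift 2 j) = 0%R.
  by apply: etrans (block_mxEur _ _ _ _ _ _) _; rewrite mxE.
have dl (i j : 'I_2) : gmat GI (rshift 2 i) (lshift 2 j) = 0%R.
  by apply: etrans (block_mxEdl _ _ _ _ _ _) _; rewrite mxE.
have dr (i j : 'I_2) : gmat GI (rshift 2 i) (rshift 2 j) = pmat 0 (5 *+ X)%R i j.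
  by apply: etrans (block_mxEdr _ _ _ _ _ _) _; rewrite /w2 /pw map_nseq wmat_nseq.
rewrite !ul !ur !dl !dr.
have d00 : pmat 0 (5 *+ X)%R 0%R 0%R = 1%R by rewrite mxE /= mulr0 addr0.
have d01 : pmat 0 (5 *+ X)%R 0%R 1%R = 0%R by rewrite mxE /= mulr0 oppr0.
have d10 : pmat 0 (5 *+ X)%R 1%R 0%R = Posz (5 * X) by rewrite mxE /= -mulr_natr natz; lia.
have d11 : pmat 0 (5 *+ X)%R 1%R 1%R = 1%R by rewrite mxE /= mulr0 subr0.
rewrite d00 d01 d10 d11.
have -> : 9 * 2 ^ (10 * X) = code_seq [:: code_int (Posz (5 * X)); code_int 1%R].
  rewrite !code_seq_cons [code_seq [::]]/= [code_int 1%R]/= /= mulnC; congr (2 ^ _ * _).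
  by rewrite -mul2n mulnA.
by rewrite -code_seq_cat.
Qed.

End Generators.

(** * The reduction and the diagonal contradiction *)

Section Reduction.
Variable Q : program.
Local Notation M := (mM Q).
Local Notation app := (mapp Q).
Local Notation S := (mS Q).
Local Notation pre := (mpre Q).

Lemma capp_lt6 N K a b hl x : all (fun y => y < 6) (capp N K a b hl x).
Proof.
have pad6 w : all (fun y => y < 6) w -> all (fun y => y < 6) (pad K w).
  by move=> Hw; rewrite all_cat Hw all_nseq orbT.
have cols6 row : (forall r, all (fun y => y < 6) (row r)) ->
    all (fun y => y < 6) (flatten (cols N K row)).
  move=> Hrow; apply/allP => y /flattenP[c /mapP[k _ ->] /mapP[ph _ ->]]; set w := pad _ _.
  case: (ltnP k (size w)) => Hk; last by rewrite nth_default.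
  by have /all_nthP := pad6 _ (Hrow (N.-1 - ph)); apply.
case: x => [|[|[|[|[|x]]]]] //=.
- by apply: cols6 => r; rewrite /row_c; case: (hl r); rewrite ?all_nseq ?orbT.
- rewrite all_cat all_nseq orbT andbT; apply: cols6 => r; rewrite /row_h.
  by case: (hl r); rewrite /= ?all_cat ?all_nseq ?orbT.
- by rewrite all_nseq orbT.
Qed.

Lemma halts_identity x : halts Q (0, [:: x]) <->
  identity_in_semigroup (mats M app S (2 ^ x) pre).
Proof.
have app6 y : all (fun y => y < 6) (app y) by apply: capp_lt6.
have pre6 : all (fun y => y < 6) pre by rewrite /mpre /cpre all_cat all_nseq orbT.
rewrite identity_mats /halts halts_tagsol; split=> [[xs]|[gs [ok gs0 H1 H2]]].
  exact: (tagsol_identity (mM_gt0 Q) pre6 app6).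
exact: (identity_tagsol (mM_gt0 Q) pre6 app6 ok gs0 H1 H2).
Qed.

(** The arguments of [gmat] are dummies: the turn and the pops do not depend on them, so these codes
    are common to all machines. *)
Definition fixed_codes : seq nat :=
  map code_mx (map (gmat 0 (fun=> [::]) 0 0 [::]) fixed_gens ++ pads).

(** [X] may be set to 0, since only [GI] involves it. *)
Definition program_code : nat :=
  code_seq (map code_mx (map (gmat M app S 0 pre) program_gens)).

Lemma code_mats x : code_gens (mats M app S (2 ^ x) pre) =
  2 ^ affs K14 (9 * 2 ^ (10 * 2 ^ x)) * (2 * affs fixed_codes program_code).+1.
Proof.
by rewrite /code_gens /mats map_cons code_seq_cons code_input map_cat code_seq_cat.
Qed.

End Reduction.

Lemma identity_undecidable :
  ~ decidable_on (fun gens : seq 'M[int]_4 => size gens = 48%N /\ uniq gens)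
                 code_gens identity_in_semigroup.
Proof.
move=> [P HP].
(* [Q] is built only from [P] and codes common to all machines, so there is no circularity in
   feeding it the code [x] of its own matrices. *)
pose Q := diag P K14 fixed_codes; pose x := program_code Q.
have [Hyes Hno] := HP (mats (mM Q) (mapp Q) (mS Q) (2 ^ x) (mpre Q))
  (conj (size_mats _ _ _ _ _) (uniq_mats _ _ _ _ _)).
have E : code_gens (mats (mM Q) (mapp Q) (mS Q) (2 ^ x) (mpre Q)) = encv K14 fixed_codes x.
  exact: code_mats.
rewrite E in Hyes Hno.
(* Membership makes [P] output 1 and [Q] run forever, although membership means that [Q] halts on
   [x]; non-membership fails symmetrically. *)
have NI : ~ identity_in_semigroup (mats (mM Q) (mapp Q) (mS Q) (2 ^ x) (mpre Q)).
  by move=> H; have /halts_identity/(diag_spec (Hyes H)) := H.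
by apply: (NI); apply/halts_identity/(diag_spec (Hno NI)).
Qed.

Theorem mainTheorem6 :
  ~ decidable_on (fun _ : seq 'M[int]_4 => True) code_gens identity_in_semigroup /\
  ~ decidable_on (fun gens : seq 'M[int]_4 => size gens = 48%N /\ uniq gens)
                 code_gens identity_in_semigroup.
Proof.
split; last exact: identity_undecidable.
by move=> [P HP]; apply: identity_undecidable; exists P => gens _; apply: HP.
Qed.
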